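(* Let $p:\mathbb{R}\to[0,1]$ be isotonic ($p(x)\le p(x')$ for $x\le x'$), and for each $n$ let $x_{n1}\le\cdots\le x_{nn}$ be fixed real numbers and $Y_{n1},\dots,Y_{nn}\in\{0,1\}$ independent with $\mathrm{pr}(Y_{ni}=1)=p(x_{ni})$. Suppose that there exist a non-degenerate interval $[a_o,b_o]$ and constants $C_1,C_2>0$ such that for sufficiently large $n$, \[ \#\{i:x_{ni}\in B\}\ \ge\ C_1\,n\,\mathrm{Leb}(B) \] for arbitrary intervals $B\subset[a_o,b_o]$ with $\mathrm{Leb}(B)\ge C_2\log(n)/n$, where $\mathrm{Leb}$ denotes Lebesgue measure. Let $\alpha\in(0,1)$, let $\rho_n=\log(n)/n$, and let $(L_n^{\alpha,\mathrm{raw}},U_n^{\alpha,\mathrm{raw}})$ be the raw confidence band computed from $(x_{ni},Y_{ni})_{i=1}^n$. Then there exist constants $C>0$ depending only on $C_1,C_2$ with the following properties: (i) Suppose that $p$ is constant on $[a_o,b_o]$. With asymptotic probability one, \begin{align*} U_n^{\alpha,\mathrm{raw}}(x)&\le p(x)+C\sqrt{\rho_n/(b_o-x)},\quad x\in[a_o,b_o),\\ L_n^{\alpha,\mathrm{raw}}(x)&\ge p(x)-C\sqrt{\rho_n/(x-a_o)},\quad x\in(a_o,b_o]. \end{align*} (ii) Suppose that $p$ is Lipschitz-continuous on $[a_o,b_o]$ with Lipschitz constant $L>0$. With asymptotic probability one, \begin{align*} U_n^{\alpha,\mathrm{raw}}(x)&\le p(x)+C(L\rho_n)^{1/3},\quad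 x\in[a_o,\,b_o-\rho_n^{1/3}L^{-2/3}],\\ L_n^{\alpha,\mathrm{raw}}(x)&\ge p(x)-C(L\rho_n)^{1/3},\quad x\in[a_o+\rho_n^{1/3}L^{-2/3},\,b_o]. \end{align*} (iii) Suppose that $p$ is discontinuous at some point $x_o\in(a_o,b_o)$. With asymptotic probability one, \begin{align*} U_n^{\alpha,\mathrm{raw}}(x)&\le p(x_o-)+C\sqrt{\rho_n/(x_o-x)},\quad x\in[a_o,x_o),\\ L_n^{\alpha,\mathrm{raw}}(x)&\ge p(x_o+)-C\sqrt{\rho_n/(x-x_o)},\quad x\in(x_o,b_o]. \end{align*} (iv) Suppose that $\lim_{x\to a_o}p(x)=0$. For sufficiently large $n$, \[ \mathbb{E}\{U_n^{\alpha,\mathrm{raw}}(x)\}\le C\inf_{y\in(x,b_o]}\{p(y)+\rho_n/(y-x)\},\quad x\in[a_o,b_o). \] Analogously, if $\lim_{x\to b_o}p(x)=1$, then for sufficiently large $n$, \[ \mathbb{E}\{1-L_n^{\alpha,\mathrm{raw}}(x)\}\le C\inf_{y\in[a_o,x)}\{1-p(y)+\rho_n/(x-y)\},\quad x\in(a_o,b_o]. \]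
   Context: ''With asymptotic probability one'' means that the probability that the displayed inequalities hold simultaneously for all $x$ in the indicated ranges tends to $1$ as $n\to\infty$. $p(x_o-)$ and $p(x_o+)$ denote the left and right limits of $p$ at $x_o$. Raw band for sample size $n$ (writing $x_i=x_{ni}$, $Y_i=Y_{ni}$): Set $x_0:=-\infty$, $x_{n+1}:=\infty$. $N$ is the number of distinct elements of $\{x_1,\dots,x_n\}$; $\mathcal{J}$ is the set of all index pairs $(j,k)$ with $1\le j\le k\le n$, $x_{j-1}<x_j$ and $x_k<x_{k+1}$; $n_{jk}=k-j+1$ and $Z_{jk}=\sum_{i=j}^kY_i$. For $x\in\mathbb{R}$, $U_n^{\alpha,\mathrm{raw}}(x)=\inf_{(j,k)\in\mathcal{J}:x_j\ge x}u^{\alpha/(N^2+N)}(Z_{jk},n_{jk})$ and $L_n^{\alpha,\mathrm{raw}}(x)=\sup_{(j,k)\in\mathcal{J}:x_k\le x}\ell^{\alpha/(N^2+N)}(Z_{jk},n_{jk})$, with infimum over the empty set equal to $1$ and supremum over the empty set equal to $0$. Clopper–Pearson bounds: for an integer $m\ge1$, $z\in\{0,\dots,m\}$ and $\delta\in(0,1)$, $u^\delta(z,m)=\max\{\xi\in[0,1]:\mathrm{pbin}(z,m,\xi)\ge\delta\}$ and $\ell^\delta(z,m)=\min\{\xi\in[0,1]:\mathrm{pbin}(z-1,m,\xi)\le 1-\delta\}$, where $\mathrm{pbin}(\cdot,m,\xi)$ is the distribution function of the binomial distribution with parameters $m$ and $\xi$. *)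

(* Defs.v *)
From mathcomp Require unstable.
From HB Require Import structures.
From mathcomp Require Import all_boot all_order all_algebra.
From mathcomp Require Import finmap.
From mathcomp Require Import all_classical all_reals all_analysis.

Set Implicit Arguments.
Unset Strict Implicit.
Unset Printing Implicit Defensive.
Import Order.TTheory GRing.Theory Num.Theory.
Import numFieldTopology.Exports numFieldNormedType.Exports.

Local Open Scope classical_set_scope.
Local Open Scope ring_scope.

(* Mutual independence of the family (X i) for i in D. *)
Definition mutually_independent d d' (T : measurableType d)
    (T' : measurableType d') (R : realType) (P : probability T R)
    (I : choiceType) (D : set I) (X : I -> {RV P >-> T'}) : Prop :=
  forall J : {fset I}, [set` J] `<=` D ->
  forall B : I -> set T', (forall i, measurable (B i)) ->
  (P (\bigcap_(i in [set` J]) (X i @^-1` B i))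
   = \prod_(i <- J) P (X i @^-1` B i))%E.

(* The rows of a triangular array may live on different probability spaces. *)
Definition asymptotic_prob_one (R : realType) (d : nat -> measure_display)
    (T : forall n, measurableType (d n)) (P : forall n, probability (T n) R)
    (E : forall n, set (T n)) : Prop :=
  P n (E n) @[n --> \oo] --> 1%E.

Section clopper_pearson.
Context {R : realType}.

(* The argument t of the distribution function is real, so that
   [pbin (z%:R - 1)] makes sense for z = 0 (and is then equal to 0). *)
Definition pbin (t : R) (m : nat) (xi : R) : R :=
  fine (binomial_prob m xi [set k : nat | k%:R <= t]).

Definition cp_upper_set (delta : R) (z m : nat) : set R :=
  [set xi | 0 <= xi <= 1 /\ pbin z%:R m xi >= delta].

Definition cp_lower_set (delta : R) (z m : nat) : set R :=
  [set xi | 0 <= xi <= 1 /\ pbin (z%:R - 1) m xi <= 1 - delta].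

(* The supremum and infimum are attained: see [cp_upper_max] and
   [cp_lower_min]. *)
Definition cp_upper (delta : R) (z m : nat) : R := sup (cp_upper_set delta z m).
Definition cp_lower (delta : R) (z m : nat) : R := inf (cp_lower_set delta z m).

End clopper_pearson.

(* A row of size n of observations is given by functions on nat, of which only
   the values at the indices 1, ..., n are relevant. *)
Section raw_band.
Context {R : realType}.
Variables (n : nat) (x : nat -> R) (y : nat -> bool).

(* x_0 = -oo and x_(n+1) = +oo *)
Definition xpad (i : nat) : \bar R :=
  if i == 0 then -oo%E else if (i <= n)%N then (x i)%:E else +oo%E.

Definition ndistinct : nat := size (undup [seq x i | i <- iota 1 n]).

Definition Jpairs : set (nat * nat) :=
  [set jk | [/\ (1 <= jk.1)%N, (jk.1 <= jk.2)%N, (jk.2 <= n)%N,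
      (xpad jk.1.-1 < xpad jk.1)%E & (xpad jk.2 < xpad jk.2.+1)%E]].

Definition njk (jk : nat * nat) : nat := (jk.2 - jk.1 + 1)%N.

Definition Zjk (jk : nat * nat) : nat := (\sum_(jk.1 <= i < jk.2.+1) y i)%N.

Definition raw_level (alpha : R) : R :=
  alpha / (ndistinct ^ 2 + ndistinct)%N%:R.

Definition raw_upper_values (alpha s : R) : set R :=
  [set cp_upper (raw_level alpha) (Zjk jk) (njk jk) |
     jk in [set jk | Jpairs jk /\ s <= x jk.1]].

Definition raw_lower_values (alpha s : R) : set R :=
  [set cp_lower (raw_level alpha) (Zjk jk) (njk jk) |
     jk in [set jk | Jpairs jk /\ x jk.2 <= s]].

Definition raw_upper (alpha s : R) : R :=
  if raw_upper_values alpha s == set0 then 1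
  else inf (raw_upper_values alpha s).

Definition raw_lower (alpha s : R) : R :=
  if raw_lower_values alpha s == set0 then 0
  else sup (raw_lower_values alpha s).

End raw_band.

Definition rho {R : realType} (n : nat) : R := ln n%:R / n%:R.

Section clopper_pearson_attained.
Context {R : realType}.

Lemma pbinE (t : R) (m : nat) (xi : R) : 0 <= xi <= 1 ->
  pbin t m xi = \sum_(k < m.+1 | (k%:R : R) <= t) binomial_pmf m xi k.
Proof.
move=> /andP[xi0 xi1]; rewrite /pbin (binomial_msum m (p0 := xi0) xi1) /msum.
rewrite (eq_bigr (fun k : 'I_m.+1 =>
    (if k%:R <= t then binomial_pmf m xi k else 0)%:E)); last first.
  move=> k _; transitivity ((binomial_pmf m xi k)%:E *
      \d_(k : nat) [set i : nat | ((i%:R : R) <= t)%R])%E; first by [].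
  rewrite diracE; case: ifPn => kt.
    by rewrite mem_set ?mule1.
  by rewrite memNset ?mule0//= => h; rewrite h in kt.
by rewrite sumEFin [RHS]big_mkcond.
Qed.

Lemma binomial_pmf_continuous (m k : nat) :
  continuous (fun xi : R => binomial_pmf m xi k).
Proof.
rewrite (_ : (fun xi : R => _) =
  horner ('X ^+ k * (1 - 'X) ^+ (m - k) *+ 'C(m, k))); last first.
  by apply/funext => xi; rewrite hornerMn !hornerE /binomial_pmf.
by move=> xi; exact: continuous_horner.
Qed.

Let pbin_sum_continuous (t : R) (m : nat) : continuous (fun xi : R =>
  \sum_(k < m.+1 | (k%:R : R) <= t) binomial_pmf m xi k).
Proof.
apply: continuous_big => [|k _]; last exact: binomial_pmf_continuous.
exact: add_continuous.
Qed.

Lemma cp_upper_set_closed (delta : R) (z m : nat) :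
  closed (cp_upper_set delta z m).
Proof.
rewrite (_ : cp_upper_set delta z m = `[0, 1] `&` (fun xi : R =>
    \sum_(k < m.+1 | (k%:R : R) <= z%:R) binomial_pmf m xi k)
    @^-1` [set r | delta <= r]); last first.
  apply/seteqP; split => xi /=; rewrite in_itv/=.
    by move=> [xi01]; rewrite pbinE.
  by move=> [xi01]; rewrite -pbinE.
apply: closedI; first exact: itv_closed.
apply: closed_comp; last exact: closed_ge.
by move=> ? _; exact: pbin_sum_continuous.
Qed.

Lemma cp_lower_set_closed (delta : R) (z m : nat) :
  closed (cp_lower_set delta z m).
Proof.
rewrite (_ : cp_lower_set delta z m = `[0, 1] `&` (fun xi : R =>
    \sum_(k < m.+1 | (k%:R : R) <= z%:R - 1) binomial_pmf m xi k)
    @^-1` [set r | r <= 1 - delta]); last first.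
  apply/seteqP; split => xi /=; rewrite in_itv/=.
    by move=> [xi01]; rewrite pbinE.
  by move=> [xi01]; rewrite -pbinE.
apply: closedI; first exact: itv_closed.
apply: closed_comp; last exact: closed_le.
by move=> ? _; exact: pbin_sum_continuous.
Qed.

Lemma cp_upper_max (delta : R) (z m : nat) : delta < 1 ->
  cp_upper_set delta z m (cp_upper delta z m) /\
  ubound (cp_upper_set delta z m) (cp_upper delta z m).
Proof.
move=> delta1.
have A0 : cp_upper_set delta z m 0.
  split; first by rewrite lexx ler01.
  rewrite pbinE ?lexx ?ler01// big_mkcond big_ord_recl /= ler0n.
  rewrite /binomial_pmf expr0 mul1r bin0 mulr1n unstable.onem0 expr1n.
  rewrite (le_trans (ltW delta1))// lerDl sumr_ge0// => k _.
  by case: ifPn => // _; rewrite binomial_pmf_ge0// lexx ler01.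
have hs : has_sup (cp_upper_set delta z m).
  by split; [exists 0 | exists 1 => xi [/andP[_ +] _]].
split; last exact: sup_upper_bound.
apply: (itv_closed_supremums (ex_intro _ _ A0) (@cp_upper_set_closed _ _ _)).
split; first exact: sup_upper_bound.
by move=> u; apply: ge_sup; case: hs.
Qed.

Lemma cp_lower_min (delta : R) (z m : nat) : (z <= m)%N -> delta < 1 ->
  cp_lower_set delta z m (cp_lower delta z m) /\
  lbound (cp_lower_set delta z m) (cp_lower delta z m).
Proof.
move=> zm delta1.
have A1 : cp_lower_set delta z m 1.
  split; first by rewrite lexx ler01.
  rewrite pbinE ?lexx ?ler01// big1 ?subr_ge0 ?ltW// => k kz.
  have km : (k < m)%N.
    by rewrite (leq_trans _ zm)// -(ler_nat R) -natr1 -lerBrDr.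
  by rewrite /binomial_pmf unstable.onem1 expr0n subn_eq0 leqNgt km/= mulr0 mul0rn.
have hi : has_inf (cp_lower_set delta z m).
  by split; [exists 1 | exists 0 => xi [/andP[+ _] _]].
split; last by apply: inf_lbound; case: hi.
apply: (itv_closed_infimums (ex_intro _ _ A1) (@cp_lower_set_closed _ _ _)).
split; first by apply: inf_lbound; case: hi.
by move=> u; apply: lb_le_inf; case: hi.
Qed.

End clopper_pearson_attained.

(* Main.v *)
(* Write m for the length of a segment (j, k). Chernoff's bound and a union bound
   over all segments show that, with probability at least 1 - 2/n, every mean
   Z_jk / m is within 6 sqrt(ln n / m) of the mean of the p(x_i), which lies
   between p(x_j) and p(x_k). The level alpha/(N^2+N) is at least n^-3 for large
   n, so the Clopper-Pearson bounds deviate from Z_jk / m by O(sqrt(ln n / m)).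
   Applied to the longest segment inside [s, t], for which m >= C1 n (t - s), this
   yields, for all s < t in [ao, bo] simultaneously,
     U(s) <= p(t) + C0 sqrt(rho/(t - s)),  L(t) >= p(s) - C0 sqrt(rho/(t - s)).
   Then (i) is t = bo (resp. s = ao), (ii) is t - s = rho^(1/3) Lip^(-2/3), and (iii)
   is t half-way between s and xo. For (iv), the Chernoff bound
   P(Bin(m, xi) <= z) <= exp(z - m xi / 2) gives U(s) <= 2 Z_jk / m + 6 ln n / m,
   whose expectation is at most 2 p(t) + (6 / C1) rho / (t - s). *)
Require Import Defs.
From HB Require Import structures.
From mathcomp Require Import all_boot all_order all_algebra.
From mathcomp Require Import finmap.
From mathcomp Require Import all_classical all_reals all_analysis.
From mathcomp Require Import measurable_realfun ring lra.

Set Implicit Arguments.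
Unset Strict Implicit.
Unset Printing Implicit Defensive.
Import Order.TTheory GRing.Theory Num.Theory.
Import numFieldTopology.Exports numFieldNormedType.Exports.

Local Open Scope classical_set_scope.
Local Open Scope ring_scope.

(** * Exponential moments and the deviation of the Clopper-Pearson bounds *)

(* The variance proxy 4 is far from optimal, but the bound holds for all real t,
   whence no restriction on the deviations in the Chernoff bounds below. *)
Lemma bernoulli_mgf_le (R : realType) (q t : R) : 0 <= q <= 1 ->
  1 - q + q * expR t <= expR (q * t + 2 * t ^+ 2).
Proof.
move=> /andP[q0 q1]; have e0 := expR_gt0 t.
(* For t > 1/2, 2 t^2 exceeds t, and exp(t) already dominates the left side. For t <= 1/2, exp(t) <=
   1/(1 - t) <= 1 + t + 2 t^2, and mixing with weight q leaves a surplus (1 - q) 2 t^2. *)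
have [t2|t2] := leP t 2^-1; last first.
  have et : expR t <= expR (q * t + 2 * t ^+ 2) by rewrite ler_expR; nra.
  apply: le_trans et; have := expR_ge1Dx t; nra.
have e1 : expR t <= 1 + t + 2 * t ^+ 2.
  rewrite -[t in expR t]opprK expRN -[leRHS]invrK lef_pV2 ?posrE ?expR_gt0//; last first.
    by rewrite invr_gt0; nra.
  apply: le_trans (expR_ge1Dx _).
  have h0 : 0 < 1 + t + 2 * t ^+ 2 by nra.
  have h1 : 0 <= t ^+ 2 * (1 - 2 * t) by rewrite mulr_ge0 ?sqr_ge0//; lra.
  rewrite -div1r ler_pdivrMr// -subr_ge0.
  by rewrite (_ : _ - 1 = t ^+ 2 * (1 - 2 * t))//; ring.
have h2 : q * expR t <= q * (1 + t + 2 * t ^+ 2) by rewrite ler_wpM2l.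
have h3 : 0 <= (1 - q) * t ^+ 2 by rewrite mulr_ge0 ?sqr_ge0// subr_ge0.
by have h4 := expR_ge1Dx (q * t + 2 * t ^+ 2); lra.
Qed.

Lemma binomial_pgf (R : realType) (m : nat) (xi r : R) :
  \sum_(k < m.+1) binomial_pmf m xi k * r ^+ k = (1 - xi + xi * r) ^+ m.
Proof.
rewrite exprDn; apply: eq_bigr => k _.
rewrite /binomial_pmf /= exprMn mulrnAl /unstable.onem.
by rewrite -mulrA mulrCA.
Qed.

(** Exponential Markov inequality: for t <= 0 the indicator of k <= z is at most exp(t (k - z)), and
    summing against the binomial weights gives the generating function at exp(t). *)
Lemma cp_upper_set_mgf (R : realType) (delta xi t : R) (z m : nat) :
  t <= 0 -> cp_upper_set delta z m xi ->
  delta <= expR (- t * z%:R) * (1 - xi + xi * expR t) ^+ m.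
Proof.
move=> t0 [xi01]; rewrite pbinE// => /le_trans; apply.
rewrite -binomial_pgf big_mkcond mulr_sumr ler_sum// => k _.
have p0 := @binomial_pmf_ge0 _ m xi k xi01.
case: ifPn => [kz|_]; last by rewrite !mulr_ge0 ?expR_ge0 ?exprn_ge0 ?expR_ge0.
rewrite mulrCA -expRM_natr -expRD -[leLHS]mulr1 ler_wpM2l// -[leLHS]expR0 ler_expR.
by rewrite mulNr addrC -mulrBr mulr_le0// subr_le0.
Qed.

(** Membership means P(Bin(m, xi) >= z) >= [delta], and for t >= 0 the indicator of k >= z is at
    most exp(t (k - z)). The conclusion has the same form as for the upper set, so that one
    inversion serves both bounds. *)
Lemma cp_lower_set_mgf (R : realType) (delta xi t : R) (z m : nat) :
  0 <= t -> cp_lower_set delta z m xi ->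
  delta <= expR (- t * z%:R) * (1 - xi + xi * expR t) ^+ m.
Proof.
move=> t0 [xi01]; rewrite pbinE// => h.
have tot : \sum_(k < m.+1) binomial_pmf m xi k = 1.
  have := binomial_pgf m xi 1; rewrite mulr1 subrK expr1n => <-.
  by apply: eq_bigr => k _; rewrite expr1n mulr1.
have : delta <= \sum_(k < m.+1 | ~~ ((k%:R : R) <= z%:R - 1)) binomial_pmf m xi k.
  by move: tot; rewrite (bigID (fun k : 'I_m.+1 => (k%:R : R) <= z%:R - 1))/=; lra.
move=> /le_trans; apply.
rewrite -binomial_pgf big_mkcond mulr_sumr ler_sum// => k _.
have p0 := @binomial_pmf_ge0 _ m xi k xi01.
case: ifPn => [kz|_]; last by rewrite !mulr_ge0 ?expR_ge0 ?exprn_ge0 ?expR_ge0.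
rewrite mulrCA -expRM_natr -expRD -[leLHS]mulr1 ler_wpM2l// -[leLHS]expR0 ler_expR.
have : (z%:R : R) <= k%:R.
  by rewrite ler_nat leqNgt; apply: contra kz => kz; rewrite lerBrDr natr1 ler_nat.
by rewrite mulNr addrC -mulrBr => kz'; rewrite mulr_ge0// subr_ge0.
Qed.

(** The tilt -eta/4 is optimal for the variance proxy 4. As z = (xi - eta) m, the terms in xi cancel
    and the exponent becomes -m eta^2/8, whence m eta^2/8 <= lam. The sign of eta is free, which
    covers both tails. *)
Lemma chernoff_radius (R : realType) (lam xi : R) (z m : nat) : (0 < m)%N ->
  0 <= xi <= 1 -> let eta := xi - z%:R / m%:R in
  expR (- lam) <=
    expR (eta / 4 * z%:R) * (1 - xi + xi * expR (- (eta / 4))) ^+ m ->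
  `|eta| <= Num.sqrt (8 * lam / m%:R).
Proof.
move=> m0 xi01 eta h.
have m0' : (0 : R) < m%:R by rewrite ltr0n.
have : expR (- lam) <= expR (eta / 4 * z%:R + (xi * - (eta / 4) + 2 * (- (eta / 4)) ^+ 2) * m%:R).
  apply: le_trans h _; rewrite expRD [X in _ <= _ * X]expRM_natr ler_wpM2l ?expR_ge0// lerXn2r//.
  - by rewrite nnegrE; have e0 := expR_ge0 (- (eta / 4)); nra.
  - by rewrite nnegrE expR_ge0.
  - exact: bernoulli_mgf_le.
rewrite ler_expR => h2.
have zE : z%:R = (xi - eta) * m%:R by rewrite /eta; field; rewrite gt_eqF.
rewrite -sqrtr_sqr ler_wsqrtr// ler_pdivlMr//.
move: h2; rewrite zE; nra.
Qed.

Lemma cp_upper_le_hoeffding (R : realType) (lam delta : R) (z m : nat) : (0 < m)%N ->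
  delta < 1 -> expR (- lam) <= delta ->
  cp_upper delta z m <= z%:R / m%:R + Num.sqrt (8 * lam / m%:R).
Proof.
move=> m0 d1 hd; have [us _] := @cp_upper_max R delta z m d1.
set xi := cp_upper _ _ _ in us *.
(* Only when the maximum lies beyond z/m does the tilt have the sign that the exponential bound
   requires; otherwise the claim is trivial. *)
have [h|h] := leP xi (z%:R / m%:R).
  by rewrite (le_trans h)// lerDl sqrtr_ge0.
rewrite -lerBlDl; apply: le_trans (ler_norm _) _.
apply: chernoff_radius => //; first by case: us.
apply: le_trans hd _.
have := @cp_upper_set_mgf R delta xi (- ((xi - z%:R / m%:R) / 4)) z m _ us.
rewrite opprK; apply; lra.
Qed.

Lemma cp_lower_ge_hoeffding (R : realType) (lam delta : R) (z m : nat) : (0 < m)%N ->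
  (z <= m)%N -> delta < 1 -> expR (- lam) <= delta ->
  z%:R / m%:R - Num.sqrt (8 * lam / m%:R) <= cp_lower delta z m.
Proof.
move=> m0 zm d1 hd; have [us _] := @cp_lower_min R delta z m zm d1.
set xi := cp_lower _ _ _ in us *.
have [h|h] := leP (z%:R / m%:R) xi.
  by rewrite (le_trans _ h)// gerBl sqrtr_ge0.
rewrite lerBlDl -lerBlDr -opprB.
apply: le_trans (ler_norm _) _; rewrite normrN.
apply: chernoff_radius => //; first by case: us.
apply: le_trans hd _.
have := @cp_lower_set_mgf R delta xi (- ((xi - z%:R / m%:R) / 4)) z m _ us.
rewrite opprK; apply; lra.
Qed.

Lemma expRN1_le_half (R : realType) : expR (-1 : R) <= 2^-1.
Proof.
by rewrite expRN lef_pV2 ?posrE ?expR_gt0//; have := expR_ge1Dx (1 : R); lra.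
Qed.

(** With the fixed tilt -1, 1 - xi + xi/e <= 1 - xi/2 <= exp(-xi/2), so that m xi/2 - z <= lam. The
    bound is linear in lam/m instead of a square root, which is the source of the faster rate where
    p is near 0 or 1. *)
Lemma poisson_radius (R : realType) (lam xi : R) (z m : nat) : (0 < m)%N ->
  0 <= xi <= 1 ->
  expR (- lam) <= expR z%:R * (1 - xi + xi * expR (-1)) ^+ m ->
  xi <= 2 * (z%:R / m%:R) + 2 * lam / m%:R.
Proof.
move=> m0 xi01 h.
have m0' : (0 : R) < m%:R by rewrite ltr0n.
have : expR (- lam) <= expR (z%:R - xi / 2 * m%:R).
  apply: le_trans h _; rewrite expRD ler_wpM2l ?expR_ge0// -mulNr expRM_natr lerXn2r//.
  - by rewrite nnegrE; have e0 := expR_ge0 (-1 : R); nra.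
  - by rewrite nnegrE expR_ge0.
  - apply: le_trans (expR_ge1Dx _); have e1 := expRN1_le_half R; nra.
rewrite ler_expR => h2.
rewrite mulrA -mulrDl ler_pdivlMr//; lra.
Qed.

Lemma cp_upper_le_poisson (R : realType) (lam delta : R) (z m : nat) : (0 < m)%N ->
  delta < 1 -> expR (- lam) <= delta ->
  cp_upper delta z m <= 2 * (z%:R / m%:R) + 2 * lam / m%:R.
Proof.
move=> m0 d1 hd; have [us _] := @cp_upper_max R delta z m d1.
apply: poisson_radius => //; first by case: us.
apply: le_trans hd _.
have := @cp_upper_set_mgf R delta _ (-1) z m (lerN10 _) us.
by rewrite opprK mul1r.
Qed.

Lemma cp_lower_ge_poisson (R : realType) (lam delta : R) (z m : nat) : (0 < m)%N ->
  (z <= m)%N -> delta < 1 -> expR (- lam) <= delta ->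
  1 - cp_lower delta z m <= 2 * ((m - z)%N%:R / m%:R) + 2 * lam / m%:R.
Proof.
move=> m0 zm d1 hd; have [us _] := @cp_lower_min R delta z m zm d1.
apply: poisson_radius => //; first by case: us; lra.
apply: le_trans hd _.
have := @cp_lower_set_mgf R delta _ 1 z m ler01 us.
move=> /le_trans; apply.
set xi := cp_lower _ _ _.
(* Successes and failures are exchanged: pulling out exp(1) turns the generating function of Bin(m,
   xi) at tilt 1 into that of Bin(m, 1 - xi) at tilt -1. *)
have -> : 1 - xi + xi * expR 1 = expR 1 * (1 - (1 - xi) + (1 - xi) * expR (-1)).
  by rewrite mulrDr [expR 1 * ((1 - xi) * _)]mulrCA expRxMexpNx_1; ring.
rewrite exprMn -expRM_natr mulrA -expRD natrB//.
by rewrite (_ : - 1 * z%:R + 1 * m%:R = m%:R - z%:R :> R)//; ring.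
Qed.

(** * Law of a row and concentration of all segment sums *)

Lemma Zjk_local (n : nat) (y y' : nat -> bool) jk : (1 <= jk.1)%N -> (jk.2 <= n)%N ->
  (forall i, (1 <= i <= n)%N -> y i = y' i) -> Zjk y jk = Zjk y' jk.
Proof.
move=> j1 kn yy'; apply: eq_big_nat => i /andP[ji ik]; rewrite yy'//.
by rewrite (leq_trans j1 ji) (leq_trans _ kn).
Qed.

Section row_law.
Context d (T : measurableType d) (R : realType) (P : probability T R).
Variables (Y : nat -> {RV P >-> bool}) (n : nat) (q : nat -> R).
Hypothesis Yind : mutually_independent [set i | (1 <= i <= n)%N] Y.
Hypothesis Yq : forall i, (1 <= i <= n)%N -> P (Y i @^-1` [set true]) = (q i)%:E.

(** The row as a random element of a finite type, which reduces probabilities to finite sums. The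
    ordinal i stands for the index i + 1. *)
Definition sample_row (w : T) : {ffun 'I_n -> bool} := [ffun i => Y (val i).+1 w].

Definition row_pmf (b : {ffun 'I_n -> bool}) : R :=
  \prod_i (if b i then q (val i).+1 else 1 - q (val i).+1).

Let YqP i b : (1 <= i <= n)%N ->
  P (Y i @^-1` [set b]) = (if b then q i else 1 - q i)%:E.
Proof.
move=> hi; case: b; first exact: Yq.
rewrite (_ : _ @^-1` _ = ~` (Y i @^-1` [set true])); last first.
  by apply/seteqP; split => w /=; case: (Y i w).
by rewrite probability_setC ?Yq//; exact: measurable_funPTI.
Qed.

(** The atom takes the form of the intersection in [mutually_independent]. The target sets must be
    given at all natural numbers, hence the default [true]; the intersection ranges over 1, ..., n
    only. *)
Let sample_row_atom (b : {ffun 'I_n -> bool}) :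
  sample_row @^-1` [set b] =
  \bigcap_(i in [set` [fset i | i in iota 1 n]%fset])
    (Y i @^-1` [set (if insub i.-1 is Some k then b k else true)]).
Proof.
apply/seteqP; split => w /=.
  move=> <- i /=; rewrite !inE/= mem_iota => /andP[i0 i1].
  rewrite add1n ltnS in i1.
  case: insubP => [k _ ki|]; first by rewrite ffunE ki prednK.
  by rewrite prednK// i1.
move=> h; apply/ffunP => k; rewrite ffunE.
have /= -> := h (val k).+1; first by rewrite valK.
by rewrite !inE mem_iota/= ltnS ltn_ord.
Qed.

Lemma measurable_sample_row_atom b : measurable (sample_row @^-1` [set b]).
Proof.
rewrite sample_row_atom; apply: fin_bigcap_measurable => // i _.
exact: measurable_funPTI.
Qed.

Lemma sample_row_pmf b : P (sample_row @^-1` [set b]) = (row_pmf b)%:E.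
Proof.
rewrite sample_row_atom Yind//; last first.
  by move=> i /=; rewrite !inE/= mem_iota add1n ltnS.
rewrite (perm_big (iota 1 n)); last first.
  apply: uniq_perm; [exact: fset_uniq|exact: iota_uniq|].
  by move=> i; rewrite !inE.
rewrite -[1%N]addn0 iotaDl big_map -val_enum_ord big_map big_enum/= /row_pmf.
rewrite -prodEFin; apply: eq_bigr => k _.
by rewrite add1n/= YqP ?ltn_ord// valK.
Qed.

Let sample_row_setE (A : pred {ffun 'I_n -> bool}) :
  [set w | A (sample_row w)] =
  \bigcup_(b in [set` A]) (sample_row @^-1` [set b]).
Proof.
by apply/seteqP; split => w /= => [Aw|[b Ab /= ->]//]; exists (sample_row w).
Qed.

Lemma measurable_sample_row (A : pred {ffun 'I_n -> bool}) :
  measurable [set w | A (sample_row w)].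
Proof.
rewrite sample_row_setE; apply: fin_bigcup_measurable => // b _.
exact: measurable_sample_row_atom.
Qed.

Lemma sample_row_prob (A : pred {ffun 'I_n -> bool}) :
  P [set w | A (sample_row w)] = (\sum_(b | A b) row_pmf b)%:E.
Proof.
rewrite sample_row_setE measure_fin_bigcup//=.
- rewrite -(@bigfs _ _ _ _ (index_enum _)) ?index_enum_uniq//; last first.
    by move=> b _; rewrite mem_index_enum.
  by rewrite -sumEFin; apply: eq_bigr => b _; rewrite sample_row_pmf.
- by move=> b c _ _ [w []] /= -> ->.
- by move=> b _; exact: measurable_sample_row_atom.
Qed.

Lemma row_pmf_ge0 b : (forall i, 0 <= q i <= 1) -> 0 <= row_pmf b.
Proof.
move=> q01; apply: prodr_ge0 => i _; case/andP: (q01 (val i).+1) => q0 q1.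
by case: ifP; rewrite // subr_ge0.
Qed.

(** Both the weights and the exponential factor over the indices, and distributivity exchanges the
    sum over rows with the product. *)
Lemma row_mgf (t : 'I_n -> R) :
  \sum_b row_pmf b * expR (\sum_i t i * (b i)%:R) =
  \prod_(i < n) (1 - q i.+1 + q i.+1 * expR (t i)).
Proof.
under eq_bigr do rewrite expR_sum -big_split /=.
transitivity (\prod_(i < n) \sum_b0 (if b0 then q i.+1 else 1 - q i.+1) * expR (t i * b0%:R)).
  by rewrite bigA_distr_bigA.
by apply: eq_bigr => i _; rewrite big_bool/= mulr1 mulr0 expR0 mulr1 addrC.
Qed.

(** A right inverse of sampling up to the values outside 1, ..., n, which functions satisfying
    [row_local] do not see. *)
Definition row_decode (b : {ffun 'I_n -> bool}) (i : nat) : bool :=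
  if insub i.-1 is Some k then b k else false.

Lemma row_decodeS b (i : 'I_n) : row_decode b i.+1 = b i.
Proof. by rewrite /row_decode/= valK. Qed.

Lemma row_decode_sample w i : (1 <= i <= n)%N ->
  row_decode (sample_row w) i = Y i w.
Proof.
case: i => //= i i_n; have -> : i = Ordinal i_n by [].
by rewrite row_decodeS ffunE.
Qed.

(** Such functions factor through the finite type of rows. Hence they are measurable for any target,
    even when they involve uncountably many arguments of the band at once. *)
Definition row_local U (F : (nat -> bool) -> U) :=
  forall y y', (forall i, (1 <= i <= n)%N -> y i = y' i) -> F y = F y'.

Lemma row_local_sample U (F : (nat -> bool) -> U) w : row_local F ->
  F (fun i => Y i w) = F (row_decode (sample_row w)).
Proof. by move=> Floc; apply: Floc => i hi; rewrite row_decode_sample. Qed.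

Lemma row_local_setE (Q : (nat -> bool) -> Prop) : row_local Q ->
  [set w | Q (fun i => Y i w)] =
  [set w | (fun b => `[< Q (row_decode b) >]) (sample_row w)].
Proof.
by move=> Qloc; apply/seteqP; split => w /=; rewrite row_local_sample// => /asboolP.
Qed.

Lemma row_local_measurable (Q : (nat -> bool) -> Prop) : row_local Q ->
  measurable [set w | Q (fun i => Y i w)].
Proof.
move=> /row_local_setE ->.
exact: (measurable_sample_row (fun b => `[< Q (row_decode b) >])).
Qed.

Lemma row_local_measurable_fun d' (U : measurableType d') (F : (nat -> bool) -> U) :
  row_local F -> measurable_fun [set: T] (fun w => F (fun i => Y i w)).
Proof.
move=> Floc _ B _; rewrite setTI.
apply: (@row_local_measurable (fun y => B (F y))) => y y' yy'.
by rewrite (Floc _ _ yy').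
Qed.

Lemma row_local_prob (Q : (nat -> bool) -> Prop) : row_local Q ->
  P [set w | Q (fun i => Y i w)] =
  (\sum_(b | `[< Q (row_decode b) >]) row_pmf b)%:E.
Proof.
move=> /row_local_setE ->.
exact: (sample_row_prob (fun b => `[< Q (row_decode b) >])).
Qed.

Hypothesis q01 : forall i, 0 <= q i <= 1.

Lemma sum_nat_ord (V : nmodType) (F : nat -> V) (j k : nat) : (k < n)%N ->
  \sum_(j <= i < k.+1) F i = \sum_(i < n | (j <= i <= k)%N) F i.
Proof.
move=> kn; rewrite (big_nat_widen _ _ n)//= (big_nat_widenl _ 0)//= big_mkord.
by apply: eq_bigl => i; rewrite ltnS andbC.
Qed.

Lemma sum_natS_ord (V : nmodType) (F : nat -> V) (j k : nat) : (k < n)%N ->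
  \sum_(j.+1 <= i < k.+2) F i = \sum_(i < n) (if (j <= i <= k)%N then F i.+1 else 0).
Proof. by move=> kn; rewrite big_add1/= sum_nat_ord// big_mkcond. Qed.

(** In [row_mgf] take the weight t on the segment and 0 elsewhere. The centring cancels the linear
    terms q t of the Bernoulli bound, and each index of the segment leaves 2 t^2. *)
Lemma segment_mgf (j k : 'I_n) (t : R) : (j <= k)%N ->
  \sum_b row_pmf b *
    expR (t * ((Zjk (row_decode b) (j.+1, k.+1))%:R - \sum_(j.+1 <= i < k.+2) q i))
  <= expR (2 * t ^+ 2 * (njk (j.+1, k.+1))%:R).
Proof.
move=> jk; set S := fun i : nat => (j <= i <= k)%N.
pose u (i : 'I_n) : R := if S i then t else 0.
have ZE b : t * (Zjk (row_decode b) (j.+1, k.+1))%:R = \sum_i u i * (b i)%:R.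
  rewrite /Zjk/= natr_sum sum_natS_ord// mulr_sumr; apply: eq_bigr => i _.
  by rewrite /u /S; case: ifPn; rewrite ?mulr0 ?mul0r// row_decodeS.
have mE : (njk (j.+1, k.+1))%:R = \sum_(i < n) (if S i then 1 else 0) :> R.
  rewrite -(@sum_natS_ord _ (fun=> 1))// sumr_const_nat /njk/= subSS addn1 subSS.
  by rewrite subSn.
under eq_bigr do rewrite mulrBr ZE expRD mulrA.
rewrite -mulr_suml row_mgf.
apply: (@le_trans _ _ (expR (\sum_(i < n) (q i.+1 * u i + 2 * u i ^+ 2)) *
    expR (- (t * \sum_(j.+1 <= i < k.+2) q i)))).
  rewrite ler_wpM2r ?expR_ge0// expR_sum; apply: ler_prod => i _.
  case/andP: (q01 i.+1) => q0 q1.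
  rewrite bernoulli_mgf_le ?q0// andbT.
  by have e0 := expR_ge0 (u i); nra.
rewrite -expRD ler_expR mE sum_natS_ord// !mulr_sumr -sumrB.
rewrite big_mkcond /= ler_sum// => i _.
by rewrite /u -/(S i); case: ifP => _; lra.
Qed.

(* The radius 6 sqrt(ln n / m) makes every single deviation have probability at
   most 2 n^(-9/2) <= 2 n^(-3), which leaves 2/n after summing over n^2 segments. *)
Definition good_row (y : nat -> bool) : Prop :=
  forall j k : nat, (1 <= j)%N -> (j <= k)%N -> (k <= n)%N ->
  `|(Zjk y (j, k))%:R - \sum_(j <= i < k.+1) q i| <=
    (njk (j, k))%:R * (6 * Num.sqrt (ln n%:R / (njk (j, k))%:R)).

Lemma good_row_local : row_local good_row.
Proof.
have H y y' : (forall i, (1 <= i <= n)%N -> y i = y' i) -> good_row y -> good_row y'.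
  move=> yy' gy j k j1 jk kn; rewrite -(@Zjk_local n y)//.
  exact: (gy j k).
move=> y y' yy'; apply/propext; split; apply: H => // i hi.
by rewrite yy'.
Qed.

(** At the tilts eta/4 and -eta/4 the exponent is 2 t^2 m - m eta^2/4 = -m eta^2/8. Since m eta^2 =
    36 ln n, this is -(9/2) ln n <= -3 ln n. *)
Let tail_bound (j k : 'I_n) (m eta : R) : (0 < n)%N -> (j <= k)%N ->
  m = (njk (j.+1, k.+1))%:R -> eta = 6 * Num.sqrt (ln n%:R / m) ->
  \sum_b row_pmf b *
    (expR (eta / 4 * ((Zjk (row_decode b) (j.+1, k.+1))%:R -
       \sum_(j.+1 <= i < k.+2) q i - m * eta)) +
     expR (- (eta / 4) * ((Zjk (row_decode b) (j.+1, k.+1))%:R -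
       \sum_(j.+1 <= i < k.+2) q i + m * eta)))
  <= 2 * (n%:R ^- 3).
Proof.
move=> n0 jk mE etaE.
pose D b := (Zjk (row_decode b) (j.+1, k.+1))%:R - \sum_(j.+1 <= i < k.+2) q i.
have m0 : 0 < m by rewrite mE ltr0n /njk addn1.
have ln0 : 0 <= ln (n%:R : R) by rewrite ln_ge0// ler1n.
have eta2 : m * eta ^+ 2 = 36 * ln n%:R.
  by rewrite etaE exprMn sqr_sqrtr ?divr_ge0// ?ltW//; field; rewrite gt_eqF.
have nE : n%:R ^- 3 = expR (- (3 * ln n%:R)) :> R.
  by rewrite expRN expRM_natl lnK// posrE ltr0n.
have B (t : R) : t ^+ 2 = (eta / 4) ^+ 2 ->
    \sum_b row_pmf b * expR (t * D b) * expR (- (eta / 4 * (m * eta))) <= n%:R ^- 3.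
  move=> tE; rewrite -mulr_suml.
  apply: (@le_trans _ _ (expR (2 * t ^+ 2 * m) * expR (- (eta / 4 * (m * eta))))).
    by rewrite ler_wpM2r ?expR_ge0// mE segment_mgf.
  by rewrite nE -expRD ler_expR tE; nra.
rewrite (_ : 2 * _ = n%:R ^- 3 + n%:R ^- 3); last by ring.
under eq_bigr do rewrite mulrDr.
rewrite big_split/= lerD//.
  apply: le_trans (B (eta / 4) erefl); apply: ler_sum => b _.
  by rewrite -[leRHS]mulrA -expRD -/(D b) -mulrBr.
apply: le_trans (B (- (eta / 4)) _); last by rewrite sqrrN.
apply: ler_sum => b _; rewrite -[leRHS]mulrA -expRD -/(D b).
by rewrite -[- (eta / 4 * (m * eta))]mulNr -mulrDr.
Qed.

Lemma good_row_prob : (0 < n)%N ->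
  ((1 - 2 / n%:R)%:E <= P [set w | good_row (fun i => Y i w)])%E.
Proof.
move=> n0.
have n0' : (0 : R) < n%:R by rewrite ltr0n.
have tot : \sum_b row_pmf b = 1.
  apply: EFin_inj; rewrite -(sample_row_prob xpredT)//.
  by rewrite (_ : [set w | _] = setT) ?probability_setT//; apply/seteqP; split.
rewrite row_local_prob; last exact: good_row_local.
rewrite lee_fin lerBlDr.
move: tot; rewrite (bigID (fun b => `[< good_row (row_decode b) >]))/= => {}tot.
rewrite -[leLHS]tot lerD2l.
pose m (jk : 'I_n * 'I_n) : R := (njk (jk.1.+1, jk.2.+1))%:R.
pose eta jk := 6 * Num.sqrt (ln n%:R / m jk).
pose D b (jk : 'I_n * 'I_n) : R := 
  (Zjk (row_decode b) (jk.1.+1, jk.2.+1))%:R - \sum_(jk.1.+1 <= i < jk.2.+2) q i.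
pose E b jk := expR (eta jk / 4 * (D b jk - m jk * eta jk)) +
   expR (- (eta jk / 4) * (D b jk + m jk * eta jk)).
have E0 b jk : 0 <= E b jk by rewrite addr_ge0// expR_ge0.
(* Markov and union bound in one: on a bad row some segment deviates too far, and its exponential of
   the matching sign is at least 1, so that the sum of all exponentials dominates the indicator of
   bad rows. *)
apply: (@le_trans _ _ (\sum_b row_pmf b * \sum_(jk : 'I_n * 'I_n | (jk.1 <= jk.2)%N) E b jk)).
  rewrite big_mkcond; apply: ler_sum => b _.
  have p0 := row_pmf_ge0 b q01.
  case: ifPn => [/asboolPn bad|_]; last by rewrite mulr_ge0// sumr_ge0.
  rewrite -[leLHS]mulr1 ler_wpM2l//.
  have [jk [jk12 hjk]] : exists jk : 'I_n * 'I_n, (jk.1 <= jk.2)%N /\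
      m jk * eta jk < `|D b jk|.
    apply: contrapT => /forallNP h; apply: bad => -[//|j] [//|k] _ jk kn.
    have /not_andP[//|/negP] := h (Ordinal (leq_ltn_trans (jk : (j <= k)%N) kn), Ordinal kn).
    by rewrite -leNgt.
  rewrite (bigD1 jk)//= -[leLHS]addr0 lerD//; last by rewrite sumr_ge0.
  have eta0 : 0 <= eta jk by rewrite mulr_ge0// sqrtr_ge0.
  have [Dp|Dn] := leP 0 (D b jk).
    rewrite -[leLHS]addr0 lerD ?expR_ge0// -expR0 ler_expR.
    move: hjk; rewrite ger0_norm// => hjk.
    by rewrite mulr_ge0 ?divr_ge0// subr_ge0 ltW.
  rewrite -[leLHS]add0r lerD ?expR_ge0// -expR0 ler_expR.
  move: hjk; rewrite ltr0_norm// => hjk.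
  rewrite mulr_le0// ?oppr_le0 ?divr_ge0//; lra.
rewrite (eq_bigr (fun b =>
  \sum_(jk : 'I_n * 'I_n | (jk.1 <= jk.2)%N) row_pmf b * E b jk)); last first.
  by move=> b _; rewrite mulr_sumr.
rewrite exchange_big/=.
apply: (@le_trans _ _ (\sum_(jk : 'I_n * 'I_n) 2 * n%:R ^- 3)).
  rewrite big_mkcond; apply: ler_sum => jk _; case: ifPn => [jk12|_]; last first.
    by rewrite mulr_ge0// invr_ge0 exprn_ge0 ?ltW.
  exact: (@tail_bound jk.1 jk.2 (m jk) (eta jk)).
rewrite sumr_const card_prod card_ord -[leLHS]mulr_natr natrM.
rewrite le_eqVlt; apply/orP; left; apply/eqP.
by field; rewrite gt_eqF.
Qed.

End row_law.

(** * Expected counts and the size of the confidence level *)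

(** Evaluates the pointwise majorants of the band in the expectation bounds. All terms are
    nonnegative, so that nonnegative integration applies. The probabilities are prescribed on [r]
    only, because the law of the observations is given for indices 1, ..., n. *)
Lemma expectation_count d (T : measurableType d) (R : realType)
    (P : probability T R) (A : nat -> set T) (a : nat -> R) (c e : R) (r : seq nat) :
  0 <= c -> 0 <= e -> (forall i, measurable (A i)) ->
  (forall i, i \in r -> P (A i) = (a i)%:E) ->
  ('E_P[(fun w => c * \sum_(i <- r) \1_(A i) w + e)%R] =
    (c * (\sum_(i <- r) a i) + e)%:E)%E.
Proof.
move=> c0 e0 mA PA; rewrite unlock.
have mI i : measurable_fun [set: T] ((fun w => (\1_(A i) w)%:E) : T -> \bar R).
  by apply/measurable_EFinP; exact: measurable_indic.
under eq_integral do rewrite EFinD EFinM -sumEFin.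
rewrite ge0_integralD//=; last 2 first.
- by move=> w _; rewrite mule_ge0 ?lee_fin// sume_ge0// => i _; rewrite lee_fin.
- by apply: measurable_funeM; exact: emeasurable_sum.
rewrite integral_cst//= probability_setT mule1 ge0_integralZl_EFin//=; last 2 first.
- by move=> w _; rewrite sume_ge0// => i _; rewrite lee_fin.
- exact: emeasurable_sum.
rewrite ge0_integral_sum//=.
rewrite EFinD EFinM -sumEFin; congr (_ * _ + _)%E.
rewrite big_seq [RHS]big_seq; apply: eq_bigr => i ir.
by rewrite integral_indic// setIT; exact: PA.
Qed.

(** As 1 <= N <= n, N^2 + N <= 2 n^2, and n alpha >= 2 turns alpha/(2 n^2) into at least n^-3, the
    exponential on the left. *)
Lemma raw_level_ge (R : realType) (n : nat) (x : nat -> R) (alpha : R) :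
  (0 < n)%N -> 0 < alpha < 1 -> 2 <= n%:R * alpha ->
  expR (- (3 * ln n%:R)) <= raw_level n x alpha /\ raw_level n x alpha < 1.
Proof.
move=> n0 /andP[a0 a1] na.
have n0' : (0 : R) < n%:R by rewrite ltr0n.
rewrite /raw_level; set N := ndistinct n x.
have Nn : (N <= n)%N.
  by rewrite /N /ndistinct (leq_trans (size_undup _))// size_map size_iota.
have N0 : (0 < N)%N.
  rewrite lt0n /N /ndistinct size_eq0; apply/negP => /eqP E.
  have : x 1%N \in undup [seq x i | i <- iota 1 n].
    by rewrite mem_undup map_f// mem_iota/= add1n.
  by rewrite E.
have K0 : (0 : R) < (N ^ 2 + N)%:R by rewrite ltr0n addn_gt0 N0 orbT.
split; last first.
  rewrite ltr_pdivrMr// mul1r (lt_le_trans a1)// -[leLHS]/(1%:R) ler_nat.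
  by rewrite addn_gt0 N0 orbT.
rewrite expRN expRM_natl lnK ?posrE// ler_pdivlMr//.
have KN : (N ^ 2 + N)%:R <= 2 * (n%:R ^+ 2) :> R.
  rewrite -natrX -natrM ler_nat mul2n -addnn leq_add// ?leq_exp2r//.
  by rewrite (leq_trans Nn)// -{1}(expn1 n) leq_pexp2l.
rewrite ler_pdivrMl ?exprn_gt0//; apply: le_trans KN _.
have h : 0 <= n%:R ^+ 2 * (n%:R * alpha - 2) by rewrite mulr_ge0 ?sqr_ge0// subr_ge0.
by lra.
Qed.

(** * Segments of the design and elementary properties of the raw band *)

Section row_band.
Context {R : realType}.
Variables (n : nat) (x : nat -> R) (y : nat -> bool).

Lemma Zjk_le_njk jk : (jk.1 <= jk.2)%N -> (Zjk y jk <= njk jk)%N.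
Proof.
move=> jk12; rewrite /Zjk /njk addn1 -subSn// -[leqRHS]muln1 -sum_nat_const_nat.
by apply: leq_sum => i _; case: (y i).
Qed.

Lemma njk_gt0 jk : (0 < njk jk)%N. Proof. by rewrite /njk addn1. Qed.

(** Take the least j with s <= x_j and the greatest k with x_k <= t. Extremality gives the strict
    jumps before j and after k even in the presence of ties, with the infinite sentinels at j = 1
    and k = n, and places every index counted between j and k. *)
Lemma Jpairs_segment (s t : R) :
  (forall i j, (1 <= i)%N -> (i <= j)%N -> (j <= n)%N -> x i <= x j) ->
  (0 < count (fun i => x i \in `[s, t]) (iota 1 n))%N ->
  exists j k, [/\ Jpairs n x (j, k), s <= x j, x k <= t &
    (count (fun i => x i \in `[s, t]) (iota 1 n) <= njk (j, k))%N].
Proof.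
move=> xm; rewrite -has_count => /hasP[i0]; rewrite mem_iota add1n ltnS => /andP[i01 i0n].
rewrite in_itv/= => /andP[si0 i0t].
have exj : exists i, [&& (0 < i)%N, (i <= n)%N & s <= x i] by exists i0; rewrite i01 i0n.
have exk : exists i, [&& (0 < i)%N, (i <= n)%N & x i <= t] by exists i0; rewrite i01 i0n.
have bd i : [&& (0 < i)%N, (i <= n)%N & x i <= t] -> (i <= n)%N by case/and3P.
case: (ex_minnP exj) => j /and3P[j0 jn sj] jmin.
case: (ex_maxnP exk bd) => k /and3P[k0 kn kt] kmax.
have ji0 : (j <= i0)%N by apply: jmin; rewrite i01 i0n.
have i0k : (i0 <= k)%N by apply: kmax; rewrite i01 i0n.
have jk := leq_trans ji0 i0k.
exists j, k; split => //.
  split => //=.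
    rewrite /xpad (gtn_eqF j0)/= jn; case: eqP => [_|/eqP j1]; first by rewrite ltNyr.
    rewrite (leq_trans (leq_pred _) jn) lte_fin (lt_le_trans _ sj)// ltNge.
    apply/negP => h; have := jmin j.-1; rewrite h lt0n j1 (leq_trans (leq_pred _) jn)/=.
    by move=> /(_ isT); rewrite leqNgt prednK// leqnn.
  rewrite /xpad (gtn_eqF k0)/= kn; case: ifPn => [kn1|_]; last by rewrite ltry.
  rewrite lte_fin (le_lt_trans kt)// ltNge.
  by apply/negP => h; have := kmax k.+1; rewrite h kn1/= => /(_ isT); rewrite ltnn.
have -> : njk (j, k) = size (iota j (k.+1 - j)) by rewrite size_iota /njk/= addn1 subSn.
rewrite -size_filter; apply: uniq_leq_size; first by rewrite filter_uniq// iota_uniq.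
move=> i; rewrite mem_filter in_itv/= !mem_iota add1n ltnS => /andP[/andP[si it] /andP[i1 i_n]].
rewrite subnKC ?ltnS; last exact: leqW.
by rewrite jmin ?i1 ?i_n//= kmax// i1 i_n.
Qed.

Variables (alpha s : R).
Hypothesis level1 : raw_level n x alpha < 1.

Lemma cp_upper01 z m : 0 <= cp_upper (raw_level n x alpha) z m <= 1.
Proof. by have [[]] := @cp_upper_max R _ z m level1. Qed.

Lemma cp_lower01 z m : (z <= m)%N -> 0 <= cp_lower (raw_level n x alpha) z m <= 1.
Proof. by move=> zm; have [[]] := @cp_lower_min R _ z m zm level1. Qed.

Lemma raw_upper_le jk : Jpairs n x jk -> s <= x jk.1 ->
  raw_upper n x y alpha s <= cp_upper (raw_level n x alpha) (Zjk y jk) (njk jk).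
Proof.
move=> J sx; rewrite /raw_upper.
have V : raw_upper_values n x y alpha s
    (cp_upper (raw_level n x alpha) (Zjk y jk) (njk jk)) by exists jk.
case: ifPn => [/eqP E|_]; first by rewrite E in V.
by apply: ge_inf => //; exists 0 => _ [jk' _ <-]; case/andP: (cp_upper01 (Zjk y jk') (njk jk')).
Qed.

Lemma raw_lower_ge jk : Jpairs n x jk -> x jk.2 <= s ->
  cp_lower (raw_level n x alpha) (Zjk y jk) (njk jk) <= raw_lower n x y alpha s.
Proof.
move=> J sx; rewrite /raw_lower.
have V : raw_lower_values n x y alpha s
    (cp_lower (raw_level n x alpha) (Zjk y jk) (njk jk)) by exists jk.
case: ifPn => [/eqP E|_]; first by rewrite E in V.
apply: ub_le_sup => //; exists 1 => _ [jk' [[_ jk12 _ _ _] _] <-].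
by case/andP: (cp_lower01 (Zjk_le_njk jk12)).
Qed.

Lemma raw_upper01 : 0 <= raw_upper n x y alpha s <= 1.
Proof.
rewrite /raw_upper; case: ifPn => [_|/set0P[v Vv]]; first by rewrite ler01 lexx.
have lb : lbound (raw_upper_values n x y alpha s) 0.
  by move=> _ [jk' _ <-]; case/andP: (cp_upper01 (Zjk y jk') (njk jk')).
rewrite lb_le_inf//=; last by exists v.
apply: (@le_trans _ _ v); first by apply: ge_inf => //; exists 0.
by case: Vv => jk _ <-; case/andP: (cp_upper01 (Zjk y jk) (njk jk)).
Qed.

Lemma raw_lower01 : 0 <= raw_lower n x y alpha s <= 1.
Proof.
rewrite /raw_lower; case: ifPn => [_|/set0P[v Vv]]; first by rewrite ler01 lexx.
have ub : ubound (raw_lower_values n x y alpha s) 1.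
  by move=> _ [jk' [[_ jk12 _ _ _] _] <-]; case/andP: (cp_lower01 (Zjk_le_njk jk12)).
rewrite (ge_sup _ ub) ?andbT; last by exists v.
apply: (@le_trans _ _ v); last by apply: ub_le_sup => //; exists 1.
by case: Vv => jk [[_ jk12 _ _ _] _] <-; case/andP: (cp_lower01 (Zjk_le_njk jk12)).
Qed.
End row_band.

Lemma raw_upper_local (R : realType) n (x : nat -> R) alpha s :
  row_local n (fun y => raw_upper n x y alpha s).
Proof.
have H y y' : (forall i, (1 <= i <= n)%N -> y i = y' i) ->
    raw_upper_values n x y alpha s `<=` raw_upper_values n x y' alpha s.
  move=> yy' _ [jk [J sx] <-]; exists jk => //.
  by case: J => j1 _ kn _ _; rewrite (@Zjk_local n y' y)// => i hi; rewrite yy'.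
move=> y y' yy'; rewrite /raw_upper (_ : raw_upper_values n x y alpha s =
  raw_upper_values n x y' alpha s)//.
by apply/seteqP; split; apply: H => // i hi; rewrite yy'.
Qed.

Lemma raw_lower_local (R : realType) n (x : nat -> R) alpha s :
  row_local n (fun y => raw_lower n x y alpha s).
Proof.
have H y y' : (forall i, (1 <= i <= n)%N -> y i = y' i) ->
    raw_lower_values n x y alpha s `<=` raw_lower_values n x y' alpha s.
  move=> yy' _ [jk [J sx] <-]; exists jk => //.
  by case: J => j1 _ kn _ _; rewrite (@Zjk_local n y' y)// => i hi; rewrite yy'.
move=> y y' yy'; rewrite /raw_lower (_ : raw_lower_values n x y alpha s =
  raw_lower_values n x y' alpha s)//.
by apply/seteqP; split; apply: H => // i hi; rewrite yy'.
Qed.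

(** * Bounds for the band on good rows and in expectation *)

(** Converts the width sqrt(ln n / m) on a segment of length m >= C1 n dt into the rate sqrt(rho /
    dt); [L] stands for ln n. *)
Lemma sqrt_rate_le (R : realType) (C1 L n m dt : R) : 0 < C1 -> 0 <= L -> 0 < n ->
  0 < dt -> C1 * n * dt <= m ->
  Num.sqrt (L / m) <= Num.sqrt C1^-1 * Num.sqrt (L / n / dt).
Proof.
move=> C10 L0 n0 dt0 h.
have h0 : 0 < C1 * n * dt by rewrite !mulr_gt0.
rewrite -sqrtrM; last by rewrite invr_ge0 ltW.
rewrite ler_wsqrtr//.
rewrite (_ : C1^-1 * _ = L / (C1 * n * dt)); last by field; rewrite !gt_eqF.
by rewrite ler_wpM2l// lef_pV2// posrE (lt_le_trans h0).
Qed.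

(* 11 = 6 + 5: deviation of the segment mean plus width of the Clopper-Pearson
   bound. The summand sqrt C2 makes the bounds trivial on intervals that are too
   short for the design condition. *)
Definition band_cst {R : realType} (C1 C2 : R) : R :=
  11 * Num.sqrt C1^-1 + Num.sqrt C2.

Lemma band_cst_ge0 (R : realType) (C1 C2 : R) : 0 <= band_cst C1 C2.
Proof. by rewrite addr_ge0 ?mulr_ge0 ?sqrtr_ge0. Qed.

Section band_bounds.
Context {R : realType}.
Variables (C1 C2 : R) (p : R -> R) (n : nat) (x : nat -> R) (ao bo alpha : R).
Hypotheses (C10 : 0 < C1) (C20 : 0 < C2).
Hypotheses (p01 : forall s, 0 <= p s <= 1) (pmono : {homo p : s t / s <= t}).
Hypothesis xmono :
  forall i j, (1 <= i)%N -> (i <= j)%N -> (j <= n)%N -> x i <= x j.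
Hypotheses (n1 : (1 < n)%N) (alpha01 : 0 < alpha < 1) (nalpha : 2 <= n%:R * alpha).
Hypothesis design : forall s t, ao <= s -> s < t -> t <= bo ->
  C2 * rho n <= t - s ->
  C1 * n%:R * (t - s) <= (count (fun i => x i \in `[s, t]) (iota 1 n))%:R.

Let n0 : (0 : R) < n%:R. Proof. by rewrite ltr0n ltnW. Qed.
Let ln0 : 0 <= ln (n%:R : R). Proof. by rewrite ln_ge0// ler1n ltnW. Qed.
Let level := @raw_level_ge R n x alpha (ltnW n1) alpha01 nalpha.

Lemma rho_gt0 : (0 : R) < rho n.
Proof. by rewrite divr_gt0// ln_gt0// ltr1n. Qed.

Lemma dense_segment s t : ao <= s -> s < t -> t <= bo -> C2 * rho n <= t - s ->
  exists j k, [/\ Jpairs n x (j, k), s <= x j, x k <= t &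
    C1 * n%:R * (t - s) <= (njk (j, k))%:R].
Proof.
move=> aos st tbo h; have H := design aos st tbo h.
have c0 : (0 < count (fun i => x i \in `[s, t]) (iota 1 n))%N.
  by rewrite -(ltr0n R) (lt_le_trans _ H)// !mulr_gt0// subr_gt0.
have [j [k [J sj kt cm]]] := Jpairs_segment xmono c0.
by exists j, k; split=> //; rewrite (le_trans H)// ler_nat.
Qed.

Lemma short_interval_rate s t : s < t -> t - s < C2 * rho n ->
  1 <= Num.sqrt C2 * Num.sqrt (rho n / (t - s)).
Proof.
move=> st h; have ts : 0 < t - s by rewrite subr_gt0.
rewrite -sqrtrM; last exact: ltW.
by rewrite -[leLHS]sqrtr1 ler_wsqrtr// mulrA ler_pdivlMr// mul1r ltW.
Qed.

Lemma segment_sum_le j k : Jpairs n x (j, k) ->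
  \sum_(j <= i < k.+1) p (x i) <= (njk (j, k))%:R * p (x k).
Proof.
move=> [/= j1 jk kn _ _].
have -> : (njk (j, k))%:R * p (x k) = \sum_(j <= i < k.+1) p (x k).
  by rewrite sumr_const_nat /njk/= addn1 subSn// mulr_natl.
rewrite !big_nat; apply: ler_sum => i /andP[ji ik]; apply: pmono.
by apply: (@xmono i k); [exact: leq_trans ji| |].
Qed.

Lemma segment_sum_ge j k : Jpairs n x (j, k) ->
  (njk (j, k))%:R * p (x j) <= \sum_(j <= i < k.+1) p (x i).
Proof.
move=> [/= j1 jk kn _ _].
have -> : (njk (j, k))%:R * p (x j) = \sum_(j <= i < k.+1) p (x j).
  by rewrite sumr_const_nat /njk/= addn1 subSn// mulr_natl.
rewrite !big_nat; apply: ler_sum => i /andP[ji ik]; apply: pmono.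
by apply: (@xmono j i); [| |exact: leq_trans kn].
Qed.

(** The level n^-3 puts 8 * 3 = 24 under the root, rounded up to 25 = 5^2. *)
Let sqrt24 (m : R) : 0 < m ->
  Num.sqrt (8 * (3 * ln n%:R) / m) <= 5 * Num.sqrt (ln n%:R / m).
Proof.
move=> m0; have h0 : 0 <= ln n%:R / m by rewrite divr_ge0// ltW.
have -> : 5 * Num.sqrt (ln n%:R / m) = Num.sqrt (25 * (ln n%:R / m)).
  have e25 : (25 : R) = 5 ^+ 2 by rewrite -natrX.
  by rewrite [RHS]sqrtrM// e25 sqrtr_sqr ger0_norm.
by rewrite ler_wsqrtr//; lra.
Qed.

(** For a dense segment in [s, t], U(s) is at most its Clopper-Pearson bound, hence at most Z/m + 5
    sqrt(ln n / m); a good row gives Z/m <= p(x_k) + 6 sqrt(ln n / m), and x_k <= t. The claim is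
    deterministic, so that it holds for all s < t at once. *)
Lemma raw_upper_good y s t : good_row n (fun i => p (x i)) y ->
  ao <= s -> s < t -> t <= bo ->
  raw_upper n x y alpha s <= p t + band_cst C1 C2 * Num.sqrt (rho n / (t - s)).
Proof.
move=> gy aos st tbo; have [lev lev1] := level.
have ts : 0 < t - s by rewrite subr_gt0.
have r0 := sqrtr_ge0 (rho n / (t - s)).
have [h|h] := leP (C2 * rho n) (t - s); last first.
  have /andP[_ U1] := @raw_upper01 R n x y alpha s lev1.
  have h1 := short_interval_rate st h.
  have /andP[p0 _] := p01 t.
  have h2 : 0 <= Num.sqrt C1^-1 * Num.sqrt (rho n / (t - s)).
    by rewrite mulr_ge0// sqrtr_ge0.
  by rewrite /band_cst; lra.
have [j [k [J sj kt hm]]] := dense_segment aos st tbo h.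
have [/= j1 jk kn _ _] := J.
have m0 : (0 : R) < (njk (j, k))%:R by rewrite ltr0n njk_gt0.
apply: le_trans (raw_upper_le y lev1 J sj) _.
apply: le_trans (cp_upper_le_hoeffding _ (njk_gt0 _) lev1 lev) _.
have rate := sqrt_rate_le C10 ln0 n0 ts hm.
rewrite -/(rho n) in rate.
have q24 := sqrt24 m0.
have pk := pmono kt.
have ssum := segment_sum_le J.
have Zle : (Zjk y (j, k))%:R - \sum_(j <= i < k.+1) p (x i) <=
    (njk (j, k))%:R * (6 * Num.sqrt (ln n%:R / (njk (j, k))%:R)).
  by have := gy j k j1 jk kn; rewrite ler_norml => /andP[].
have Zm : (Zjk y (j, k))%:R / (njk (j, k))%:R <=
    p (x k) + 6 * Num.sqrt (ln n%:R / (njk (j, k))%:R).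
  by rewrite ler_pdivrMr//; lra.
have c2 : 0 <= Num.sqrt C2 * Num.sqrt (rho n / (t - s)).
  by rewrite mulr_ge0// sqrtr_ge0.
by rewrite /band_cst; lra.
Qed.

(** The same segment serves L(t): x_k <= t makes it admissible, and x_j >= s bounds its mean from
    below. *)
Lemma raw_lower_good y s t : good_row n (fun i => p (x i)) y ->
  ao <= s -> s < t -> t <= bo ->
  p s - band_cst C1 C2 * Num.sqrt (rho n / (t - s)) <= raw_lower n x y alpha t.
Proof.
move=> gy aos st tbo; have [lev lev1] := level.
have ts : 0 < t - s by rewrite subr_gt0.
have r0 := sqrtr_ge0 (rho n / (t - s)).
have [h|h] := leP (C2 * rho n) (t - s); last first.
  have /andP[L0 _] := @raw_lower01 R n x y alpha t lev1.
  have h1 := short_interval_rate st h.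
  have /andP[_ p1] := p01 s.
  have h2 : 0 <= Num.sqrt C1^-1 * Num.sqrt (rho n / (t - s)).
    by rewrite mulr_ge0// sqrtr_ge0.
  by rewrite /band_cst; lra.
have [j [k [J sj kt hm]]] := dense_segment aos st tbo h.
have [/= j1 jk kn _ _] := J.
have m0 : (0 : R) < (njk (j, k))%:R by rewrite ltr0n njk_gt0.
apply: le_trans (raw_lower_ge y lev1 J kt).
apply: le_trans (cp_lower_ge_hoeffding (njk_gt0 _) (Zjk_le_njk _ _) lev1 lev) => //.
have rate := sqrt_rate_le C10 ln0 n0 ts hm.
rewrite -/(rho n) in rate.
have q24 := sqrt24 m0.
have pk := pmono sj.
have ssum := segment_sum_ge J.
have Zge : - ((njk (j, k))%:R * (6 * Num.sqrt (ln n%:R / (njk (j, k))%:R))) <=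
    (Zjk y (j, k))%:R - \sum_(j <= i < k.+1) p (x i).
  by have := gy j k j1 jk kn; rewrite ler_norml => /andP[].
have Zm : p (x j) - 6 * Num.sqrt (ln n%:R / (njk (j, k))%:R) <=
    (Zjk y (j, k))%:R / (njk (j, k))%:R.
  by rewrite ler_pdivlMr//; lra.
have c2 : 0 <= Num.sqrt C2 * Num.sqrt (rho n / (t - s)).
  by rewrite mulr_ge0// sqrtr_ge0.
by rewrite /band_cst; lra.
Qed.

Context d (T : measurableType d) (P : probability T R) (Y : nat -> {RV P >-> bool}).
Hypothesis Yp : forall i, (1 <= i <= n)%N -> P (Y i @^-1` [set true]) = (p (x i))%:E.

Let Yp' i : (1 <= i <= n)%N -> P (Y i @^-1` [set false]) = (1 - p (x i))%:E.
Proof.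
move=> hi; rewrite (_ : _ @^-1` _ = ~` (Y i @^-1` [set true])); last first.
  by apply/seteqP; split => w /=; case: (Y i w).
by rewrite probability_setC ?Yp//; exact: measurable_funPTI.
Qed.

Let indic_preim b i w : \1_(Y i @^-1` [set b]) w = (Y i w == b)%:R :> R.
Proof. by rewrite indicE; case: eqP => h; [rewrite mem_set|rewrite memNset]. Qed.

(** Pointwise, U(s) <= 2 Z/m + 6 ln n / m, and the expectation of Z follows by linearity from the
    marginal laws. The three conditions on C come from the factor of p(t), from the factor of the
    rate, and from short intervals, where C2 rho/(t - s) >= 1 >= U. *)
Lemma expectation_raw_upper (C : R) s t : 2 <= C -> 6 / C1 <= C -> C2 <= C ->
  ao <= s -> s < t -> t <= bo ->
  ('E_P[(fun w => raw_upper n x (fun i => Y i w) alpha s)] <=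
    (C * (p t + rho n / (t - s)))%:E)%E.
Proof.
move=> C_2 C_6 C_C2 aos st tbo; have [lev lev1] := level.
have ts : 0 < t - s by rewrite subr_gt0.
have /andP[p0 _] := p01 t.
have r0 := rho_gt0.
have C0 : 0 <= C by apply: le_trans C_2.
have mU : measurable_fun [set: T] (fun w => raw_upper n x (fun i => Y i w) alpha s).
  apply: (@row_local_measurable_fun _ T R P Y n _ _ (fun y => raw_upper n x y alpha s)).
  exact: raw_upper_local.
have U0 w : 0 <= raw_upper n x (fun i => Y i w) alpha s.
  by case/andP: (@raw_upper01 R n x (fun i => Y i w) alpha s lev1).
have [h|h] := leP (C2 * rho n) (t - s); last first.
  apply: (@le_trans _ _ 'E_P[(cst 1%R : T -> R)]%E).
    apply: expectation_le => //; apply: aeW => w /=.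
    by case/andP: (@raw_upper01 R n x (fun i => Y i w) alpha s lev1).
  rewrite expectation_cst lee_fin.
  have h2 : 1 <= C2 * (rho n / (t - s)) by rewrite mulrA ler_pdivlMr// mul1r ltW.
  have h3 : 0 <= rho n / (t - s) by rewrite divr_ge0// ltW.
  by nra.
have [j [k [J sj kt hm]]] := dense_segment aos st tbo h.
have [/= j1 jk kn _ _] := J.
have m0 : (0 : R) < (njk (j, k))%:R by rewrite ltr0n njk_gt0.
set m : R := (njk (j, k))%:R in m0 hm *.
pose e := 2 * (3 * ln n%:R) / m.
have e0 : 0 <= e by rewrite divr_ge0 ?mulr_ge0// ltW.
have c0 : 0 <= 2 / m by rewrite divr_ge0// ltW.
pose V (w : T) := 2 / m * \sum_(j <= i < k.+1) \1_(Y i @^-1` [set true]) w + e.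
have mA i : measurable (Y i @^-1` [set true]) by exact: measurable_funPTI.
apply: (@le_trans _ _ 'E_P[V]%E).
  apply: expectation_le => //.
  - apply: measurable_funD => //; apply: measurable_funM => //.
    by apply: measurable_sum => i; exact: measurable_indic.
  - by move=> w; rewrite addr_ge0// mulr_ge0// sumr_ge0.
  apply: aeW => w /=.
  apply: le_trans (raw_upper_le _ lev1 J sj) _.
  apply: le_trans (cp_upper_le_poisson _ (njk_gt0 _) lev1 lev) _.
  rewrite /V -/m -/e lerD2r.
  have -> : \sum_(j <= i < k.+1) \1_(Y i @^-1` [set true]) w =
      (Zjk (fun i => Y i w) (j, k))%:R :> R.
    by rewrite /Zjk natr_sum; apply: eq_bigr => i _; rewrite indic_preim eqb_id.
  by rewrite mulrA [leRHS]mulrAC.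
rewrite /V (@expectation_count _ _ _ _ _ (fun i => p (x i)))//; last first.
  move=> i; rewrite mem_index_iota ltnS => /andP[ji ik]; apply: Yp.
  by rewrite (leq_trans j1 ji) (leq_trans ik kn).
rewrite lee_fin.
have ssum := segment_sum_le J; rewrite -/m in ssum.
have pk := pmono kt.
have s1 : 2 / m * (\sum_(j <= i < k.+1) p (x i)) <= 2 * p t.
  by rewrite mulrAC ler_pdivrMr//; nra.
have s2 : e <= 6 / C1 * (rho n / (t - s)).
  rewrite /e (_ : 6 / C1 * _ = 6 * ln n%:R / (C1 * n%:R * (t - s))); last first.
    by rewrite /rho; field; rewrite !gt_eqF.
  rewrite (_ : 2 * (3 * ln n%:R) = 6 * ln n%:R); last by ring.
  by rewrite ler_wpM2l ?mulr_ge0// lef_pV2 ?posrE// !mulr_gt0.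
have h3 : 0 <= rho n / (t - s) by rewrite divr_ge0// ltW.
by nra.
Qed.

Lemma expectation_raw_lower (C : R) s t : 2 <= C -> 6 / C1 <= C -> C2 <= C ->
  ao <= s -> s < t -> t <= bo ->
  ('E_P[(fun w => 1 - raw_lower n x (fun i => Y i w) alpha t)%R] <=
    (C * (1 - p s + rho n / (t - s)))%:E)%E.
Proof.
move=> C_2 C_6 C_C2 aos st tbo; have [lev lev1] := level.
have ts : 0 < t - s by rewrite subr_gt0.
have /andP[_ p1] := p01 s.
have r0 := rho_gt0.
have C0 : 0 <= C by apply: le_trans C_2.
have mU : measurable_fun [set: T] (fun w => 1 - raw_lower n x (fun i => Y i w) alpha t).
  apply: (@row_local_measurable_fun _ T R P Y n _ _ (fun y => 1 - raw_lower n x y alpha t)).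
  by move=> y y' yy'; rewrite (@raw_lower_local R n x alpha t y y').
have U0 w : 0 <= 1 - raw_lower n x (fun i => Y i w) alpha t.
  by rewrite subr_ge0; case/andP: (@raw_lower01 R n x (fun i => Y i w) alpha t lev1).
have [h|h] := leP (C2 * rho n) (t - s); last first.
  apply: (@le_trans _ _ 'E_P[(cst 1%R : T -> R)]%E).
    apply: expectation_le => //; apply: aeW => w /=.
    by rewrite gerBl; case/andP: (@raw_lower01 R n x (fun i => Y i w) alpha t lev1).
  rewrite expectation_cst lee_fin.
  have h2 : 1 <= C2 * (rho n / (t - s)) by rewrite mulrA ler_pdivlMr// mul1r ltW.
  have h3 : 0 <= rho n / (t - s) by rewrite divr_ge0// ltW.
  by nra.
have [j [k [J sj kt hm]]] := dense_segment aos st tbo h.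
have [/= j1 jk kn _ _] := J.
have m0 : (0 : R) < (njk (j, k))%:R by rewrite ltr0n njk_gt0.
set m : R := (njk (j, k))%:R in m0 hm *.
have mE : m = \sum_(j <= i < k.+1) 1.
  by rewrite sumr_const_nat /m /njk/= addn1 subSn.
pose e := 2 * (3 * ln n%:R) / m.
have e0 : 0 <= e by rewrite divr_ge0 ?mulr_ge0// ltW.
have c0 : 0 <= 2 / m by rewrite divr_ge0// ltW.
(* Failures are counted here: their number m - Z has expectation at most m (1 - p(s)), because x_j
   >= s. *)
pose V (w : T) := 2 / m * \sum_(j <= i < k.+1) \1_(Y i @^-1` [set false]) w + e.
have mA i : measurable (Y i @^-1` [set false]) by exact: measurable_funPTI.
apply: (@le_trans _ _ 'E_P[V]%E).
  apply: expectation_le => //.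
  - apply: measurable_funD => //; apply: measurable_funM => //.
    by apply: measurable_sum => i; exact: measurable_indic.
  - by move=> w; rewrite addr_ge0// mulr_ge0// sumr_ge0.
  apply: aeW => w /=.
  have Zm := @Zjk_le_njk (fun i => Y i w) (j, k) jk.
  apply: (@le_trans _ _ (1 - cp_lower (raw_level n x alpha) (Zjk (Y^~ w) (j, k)) (njk (j, k)))).
    by rewrite lerB// raw_lower_ge.
  apply: le_trans (cp_lower_ge_poisson (njk_gt0 _) Zm lev1 lev) _.
  rewrite /V -/m -/e lerD2r natrB// -/m.
  have -> : \sum_(j <= i < k.+1) \1_(Y i @^-1` [set false]) w =
      m - (Zjk (fun i => Y i w) (j, k))%:R :> R.
    rewrite mE /Zjk natr_sum -sumrB; apply: eq_bigr => i _.
    by rewrite indic_preim; case: (Y i w); rewrite ?subr0 ?subrr.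
  by rewrite mulrA [leRHS]mulrAC.
rewrite /V (@expectation_count _ _ _ _ _ (fun i => 1 - p (x i)))//; last first.
  move=> i; rewrite mem_index_iota ltnS => /andP[ji ik]; apply: Yp'.
  by rewrite (leq_trans j1 ji) (leq_trans ik kn).
rewrite lee_fin sumrB -mE.
have ssum := segment_sum_ge J; rewrite -/m in ssum.
have pk := pmono sj.
have s1 : 2 / m * (m - \sum_(j <= i < k.+1) p (x i)) <= 2 * (1 - p s).
  by rewrite mulrAC ler_pdivrMr//; nra.
have s2 : e <= 6 / C1 * (rho n / (t - s)).
  rewrite /e (_ : 6 / C1 * _ = 6 * ln n%:R / (C1 * n%:R * (t - s))); last first.
    by rewrite /rho; field; rewrite !gt_eqF.
  rewrite (_ : 2 * (3 * ln n%:R) = 6 * ln n%:R); last by ring.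
  by rewrite ler_wpM2l ?mulr_ge0// lef_pV2 ?posrE// !mulr_gt0.
have h3 : 0 <= rho n / (t - s) by rewrite divr_ge0// ltW.
by nra.
Qed.

End band_bounds.

(** * From good rows to asymptotic probability one; one-sided limits and rates *)

(** The event contains the good rows, of probability at least 1 - 2/n, and a squeeze concludes. [Q]
    takes the whole functions U and L, so that inequalities simultaneous in s fit; the event is
    measurable because the band is row-local. *)
Lemma good_row_asymptotic (R : realType) (p : R -> R) (x : nat -> nat -> R)
    (alpha : R) (d : nat -> measure_display) (T : forall n, measurableType (d n))
    (P : forall n, probability (T n) R) (Y : forall n, nat -> {RV (P n) >-> bool})
    (Q : nat -> (R -> R) -> (R -> R) -> Prop) :
  (forall s, 0 <= p s <= 1) ->
  (forall n, mutually_independent [set i | (1 <= i <= n)%N] (Y n)) ->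
  (forall n i, (1 <= i <= n)%N -> P n (Y n i @^-1` [set true]) = (p (x n i))%:E) ->
  (\forall n \near \oo, forall y, good_row n (fun i => p (x n i)) y ->
    Q n (raw_upper n (x n) y alpha) (raw_lower n (x n) y alpha)) ->
  asymptotic_prob_one P (fun n => [set w |
    Q n (raw_upper n (x n) (fun i => Y n i w) alpha)
        (raw_lower n (x n) (fun i => Y n i w) alpha)]).
Proof.
move=> p01 Yind Yp HQ; rewrite /asymptotic_prob_one.
have lower : (1 - 2 / n%:R : R)%:E @[n --> \oo] --> 1%E.
  apply: cvg_EFin; first exact: nearW.
  rewrite -[X in _ --> X]subr0 -[X in _ --> _ - X](mulr0 2).
  apply: cvgB; first exact: cvg_cst.
  apply: cvgM; first exact: cvg_cst.
  rewrite -cvg_shiftS; exact: cvg_harmonic.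
apply: squeeze_cvge lower (cvg_cst 1%E).
near=> n.
have n0 : (0 < n)%N by near: n; exact: nbhs_infty_gt.
have gQ : forall y, good_row n (fun i => p (x n i)) y ->
    Q n (raw_upper n (x n) y alpha) (raw_lower n (x n) y alpha).
  by near: n.
pose A y := Q n (raw_upper n (x n) y alpha) (raw_lower n (x n) y alpha).
have Aloc : row_local n A.
  move=> y y' yy'; rewrite /A; congr (Q n); apply/funext => s.
    exact: raw_upper_local.
  exact: raw_lower_local.
have mA := @row_local_measurable _ (T n) R (P n) (Y n) n _ Aloc.
have mG := @row_local_measurable _ (T n) R (P n) (Y n) n _
  (@good_row_local R n (fun i => p (x n i))).
apply/andP; split; last exact: probability_le1.
apply: le_trans (good_row_prob (Yind n) (Yp n) (fun i => p01 (x n i)) n0) _.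
apply: le_measure; rewrite ?inE//.
by move=> w; exact: gQ.
Unshelve. all: by end_near. Qed.

(** Monotonicity and boundedness make the left limit exist, so that [lim] denotes a true limit and
    the comparison passes to it. *)
Lemma le_lim_at_left (R : realType) (p : R -> R) (xo t : R) :
  (forall s, 0 <= p s <= 1) -> {homo p : s t / s <= t} -> t < xo ->
  p t <= lim (p s @[s --> xo^'-]).
Proof.
move=> p01 pm txo; apply: limr_ge.
  apply: nondecreasing_at_left_is_cvgr; apply: nearW => u.
    by move=> a b _ _; exact: pm.
  by exists 1 => _ [a _ <-]; case/andP: (p01 a).
near=> s; apply: pm; near: s; exact: nbhs_left_ge.
Unshelve. all: by end_near. Qed.

Lemma lim_at_right_le (R : realType) (p : R -> R) (xo t : R) :
  (forall s, 0 <= p s <= 1) -> {homo p : s t / s <= t} -> xo < t ->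
  lim (p s @[s --> xo^'+]) <= p t.
Proof.
move=> p01 pm txo; apply: limr_le.
  apply: nondecreasing_at_right_is_cvgr; apply: nearW => u.
    by move=> a b _ _; exact: pm.
  by exists 0 => _ [a _ <-]; case/andP: (p01 a).
near=> s; apply: pm; near: s; exact: nbhs_right_le.
Unshelve. all: by end_near. Qed.

(* The step h balances the bias L h against the stochastic error sqrt (r / h). *)
Lemma lipschitz_rate (R : realType) (L r : R) : 0 < L -> 0 < r ->
  let h := r `^ (1 / 3) * L `^ (- (2 / 3)) in
  [/\ 0 < h, L * h = (L * r) `^ (1 / 3) & Num.sqrt (r / h) = (L * r) `^ (1 / 3)].
Proof.
move=> L0 r0 h.
(* With the cube roots a of r and b of L the powers become rational: h = a / b^2, and both L h and
   sqrt(r / h) equal a b. *)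
set a := r `^ (1 / 3); set b := L `^ (1 / 3).
have a0 : 0 < a by exact: powR_gt0.
have b0 : 0 < b by exact: powR_gt0.
have cube (u : R) : 0 < u -> u = (u `^ (1 / 3)) ^+ 3.
  move=> u0; rewrite -powR_mulrn ?powR_ge0// -powRrM divfK ?pnatr_eq0//.
  by rewrite powRr1// ltW.
have ra : r = a ^+ 3 by exact: cube.
have Lb : L = b ^+ 3 by exact: cube.
have hE : h = a / b ^+ 2.
  rewrite /h -/a; congr (_ * _); rewrite powRN; congr (_^-1).
  by rewrite -powR_mulrn ?powR_ge0// -powRrM; congr (_ `^ _); field.
have LrE : (L * r) `^ (1 / 3) = b * a by rewrite powRM// ltW.
split.
- by rewrite hE divr_gt0// exprn_gt0.
- by rewrite LrE hE {1}Lb; field; rewrite gt_eqF.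
rewrite LrE hE {1}ra (_ : _ / _ = (b * a) ^+ 2); last first.
  by field; rewrite !gt_eqF.
by rewrite sqrtr_sqr ger0_norm// mulr_ge0// ltW.
Qed.

(** A member of [V] makes e finite, and then e / C is a lower bound of [V]. *)
Lemma expectation_le_inf (R : realType) (e : \bar R) (C : R) (V : set R) :
  0 < C -> V !=set0 -> (0 <= e)%E -> (forall v, V v -> (e <= (C * v)%:E)%E) ->
  (e <= (C * inf V)%:E)%E.
Proof.
move=> C0 V0 e0 h.
have [v0 Vv0] := V0.
case: e e0 h => [r| |]//; last by move=> _ /(_ _ Vv0); rewrite leye_eq.
move=> _ h; rewrite lee_fin mulrC -ler_pdivrMr//.
by apply: lb_le_inf => // v /h; rewrite lee_fin ler_pdivrMr// mulrC.
Qed.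

(** * The four statements on the raw band *)

Theorem theorem3 (R : realType) (C1 C2 : R) (hC1 : 0 < C1) (hC2 : 0 < C2) :
  exists C : R, 0 < C /\
  forall (p : R -> R) (x : nat -> nat -> R)
    (d : nat -> measure_display) (T : forall n, measurableType (d n))
    (P : forall n, probability (T n) R)
    (Y : forall n, nat -> {RV (P n) >-> bool})
    (ao bo alpha : R),
  (forall s, 0 <= p s <= 1) ->
  {homo p : s t / s <= t} ->
  (forall n i j, (1 <= i)%N -> (i <= j)%N -> (j <= n)%N -> x n i <= x n j) ->
  (forall n, mutually_independent [set i | (1 <= i <= n)%N] (Y n)) ->
  (forall n i, (1 <= i <= n)%N ->
     P n (Y n i @^-1` [set true]) = (p (x n i))%:E) ->
  ao < bo ->
  (\forall n \near \oo, forall B : interval R,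
     [set` B] `<=` `[ao, bo] ->
     ((C2 * rho n)%:E <= lebesgue_measure [set` B])%E ->
     ((C1 * n%:R)%:E * lebesgue_measure [set` B]
        <= (count (fun i => x n i \in B) (iota 1 n))%:R%:E)%E) ->
  0 < alpha < 1 ->
  let U n s (w : T n) := raw_upper n (x n) (fun i => Y n i w) alpha s in
  let L n s (w : T n) := raw_lower n (x n) (fun i => Y n i w) alpha s in
  [/\
    (* (i) *)
    {in `[ao, bo] &, forall s t, p s = p t} ->
    asymptotic_prob_one P (fun n => [set w |
      (forall s, s \in `[ao, bo[ ->
         U n s w <= p s + C * Num.sqrt (rho n / (bo - s))) /\
      (forall s, s \in `]ao, bo] ->
         L n s w >= p s - C * Num.sqrt (rho n / (s - ao)))]),
    (* (ii) *)
    forall Lip : R, 0 < Lip -> Lip.-lipschitz_`[ao, bo] p ->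
    asymptotic_prob_one P (fun n => [set w |
      (forall s, s \in `[ao, bo - rho n `^ (1 / 3) * Lip `^ (- (2 / 3))] ->
         U n s w <= p s + C * (Lip * rho n) `^ (1 / 3)) /\
      (forall s, s \in `[ao + rho n `^ (1 / 3) * Lip `^ (- (2 / 3)), bo] ->
         L n s w >= p s - C * (Lip * rho n) `^ (1 / 3))]),
    (* (iii) *)
    forall xo : R, xo \in `]ao, bo[ -> ~ {for xo, continuous p} ->
    asymptotic_prob_one P (fun n => [set w |
      (forall s, s \in `[ao, xo[ ->
         U n s w <= lim (p t @[t --> xo^'-])
                    + C * Num.sqrt (rho n / (xo - s))) /\
      (forall s, s \in `]xo, bo] ->
         L n s w >= lim (p t @[t --> xo^'+])
                    - C * Num.sqrt (rho n / (s - xo)))]),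
    (* (iv), upper bound *)
    p t @[t --> ao^'] --> (0 : R) ->
    \forall n \near \oo, forall s, s \in `[ao, bo[ ->
      ('E_(P n)[U n s] <=
        (C * inf [set (p t + rho n / (t - s))%R | t in `]s, bo]])%:E)%E
  & (* (iv), lower bound *)
    p t @[t --> bo^'] --> (1 : R) ->
    \forall n \near \oo, forall s, s \in `]ao, bo] ->
      ('E_(P n)[(fun w => 1 - L n s w)%R] <=
        (C * inf [set (1 - p t + rho n / (s - t))%R | t in `[ao, s[])%:E)%E
  ].
Proof.
pose C0 := band_cst C1 C2; have C00 : 0 <= C0 := band_cst_ge0 C1 C2.
(* The sum dominates each constant required: C0 for (i), 1 + C0 for (ii), 2 C0 for (iii), and 2,
   6/C1 and C2 for (iv). *)
pose C := 2 * C0 + C2 + 2 + 6 / C1.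
have C60 : 0 < 6 / C1 by rewrite divr_gt0.
have C_2 : 2 <= C by rewrite /C; lra.
have C_6 : 6 / C1 <= C by rewrite /C; lra.
have C_C2 : C2 <= C by rewrite /C; lra.
have C_0 : 2 * C0 <= C by rewrite /C; lra.
have C_1 : 1 + C0 <= C by rewrite /C; lra.
have Cgt0 : 0 < C by apply: lt_le_trans C_2.
exists C; split => // p x d T P Y ao bo alpha p01 pm xm Yind Yp aobo design alpha01 U L.
have [alpha0 _] := andP alpha01.
(* Everything asked of n is collected here, with the design condition read off on closed intervals,
   whose measure is t - s. *)
have ev : \forall n \near \oo, [/\ (1 < n)%N, 2 <= n%:R * alpha &
    forall s t, ao <= s -> s < t -> t <= bo -> C2 * rho n <= t - s ->
    C1 * n%:R * (t - s) <= (count (fun i => x n i \in `[s, t]) (iota 1 n))%:R].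
  near=> n; split.
  - by near: n; exact: nbhs_infty_gt.
  - by rewrite -ler_pdivrMr//; near: n; exact: nbhs_infty_ger.
  - have des : forall B : interval R, [set` B] `<=` `[ao, bo] ->
       ((C2 * rho n)%:E <= lebesgue_measure [set` B])%E ->
       ((C1 * n%:R)%:E * lebesgue_measure [set` B]
         <= (count (fun i => x n i \in B) (iota 1 n))%:R%:E)%E by near: n.
    move=> s t aos st tbo h.
    have := des `[s, t]; rewrite lebesgue_measure_itv/= lte_fin st -EFinB -EFinM !lee_fin.
    apply => // u /=; rewrite !in_itv/= => /andP[su ut].
    by rewrite (le_trans aos su) (le_trans ut tbo).
have band : \forall n \near \oo, (0 : R) < rho n /\
    forall y, good_row n (fun i => p (x n i)) y ->
    forall s t, ao <= s -> s < t -> t <= bo ->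
      raw_upper n (x n) y alpha s <= p t + C0 * Num.sqrt (rho n / (t - s)) /\
      p s - C0 * Num.sqrt (rho n / (t - s)) <= raw_lower n (x n) y alpha t.
  apply: filterS ev => n [n1 na des]; split; first exact: rho_gt0.
  move=> y gy s t aos st tbo; split.
    by apply: (@raw_upper_good R C1 C2 p n (x n) ao bo) => //; exact: xm.
  by apply: (@raw_lower_good R C1 C2 p n (x n) ao bo) => //; exact: xm.
split.
- move=> pcst.
  apply: (@good_row_asymptotic R p x alpha d T P Y (fun n Un Ln =>
      (forall s, s \in `[ao, bo[ -> Un s <= p s + C * Num.sqrt (rho n / (bo - s))) /\
      (forall s, s \in `]ao, bo] -> Ln s >= p s - C * Num.sqrt (rho n / (s - ao))))) => //.
  apply: filterS band => n [r0 bnd] y gy; split=> s; rewrite in_itv/= => /andP[s1 s2].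
    have [H _] := bnd y gy s bo s1 s2 (lexx _).
    have -> : p s = p bo by apply: pcst; rewrite in_itv/= ?s1 ?(ltW s2) ?lexx ?(ltW aobo).
    apply: le_trans H _; rewrite lerD2l ler_wpM2r ?sqrtr_ge0//; lra.
  have [_ H] := bnd y gy ao s (lexx _) s1 s2.
  have -> : p s = p ao by apply: pcst; rewrite in_itv/= ?s2 ?(ltW s1) ?lexx ?(ltW aobo).
  apply: le_trans H; rewrite lerD2l lerN2 ler_wpM2r ?sqrtr_ge0//; lra.
- move=> Lip Lip0 plip.
  apply: (@good_row_asymptotic R p x alpha d T P Y (fun n Un Ln =>
      (forall s, s \in `[ao, bo - rho n `^ (1 / 3) * Lip `^ (- (2 / 3))] ->
         Un s <= p s + C * (Lip * rho n) `^ (1 / 3)) /\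
      (forall s, s \in `[ao + rho n `^ (1 / 3) * Lip `^ (- (2 / 3)), bo] ->
         Ln s >= p s - C * (Lip * rho n) `^ (1 / 3)))) => //.
  apply: filterS band => n [r0 bnd] y gy.
  have [] := lipschitz_rate Lip0 r0.
  set h := _ `^ _ * _; set e := (_ * _) `^ _ => h0 Lh sqh.
  have e0 : 0 <= e by exact: powR_ge0.
  have lip u v : ao <= u -> u <= v -> v <= bo -> p v - p u <= Lip * (v - u).
    move=> au uv vb; apply: le_trans (ler_norm _) _.
    rewrite -[X in _ <= _ * X]ger0_norm ?subr_ge0//.
    apply: (plip (v, u)); split; rewrite /= in_itv/=.
      by rewrite vb (le_trans au uv).
    by rewrite au (le_trans uv vb).
  split=> s; rewrite in_itv/= => /andP[s1 s2].
    have s3 : s + h <= bo by rewrite -lerBrDr.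
    have s4 : s < s + h by rewrite ltrDl.
    have [H _] := bnd y gy s (s + h) s1 s4 s3.
    have H2 := lip s (s + h) s1 (ltW s4) s3.
    have sh : s + h - s = h by ring.
    rewrite sh in H H2; rewrite sqh in H; rewrite Lh in H2.
    (* The bias Lip h equals e and the stochastic error is C0 e. *)
    have h1 : (1 + C0) * e <= C * e by rewrite ler_wpM2r.
    lra.
  have s3 : ao <= s - h by rewrite lerBrDr.
  have s4 : s - h < s by rewrite gtrBl.
  have [_ H] := bnd y gy (s - h) s s3 s4 s2.
  have H2 := lip (s - h) s s3 (ltW s4) s2.
  have sh : s - (s - h) = h by ring.
  rewrite sh in H H2; rewrite sqh in H; rewrite Lh in H2.
  have h1 : (1 + C0) * e <= C * e by rewrite ler_wpM2r.
  lra.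
- move=> xo; rewrite in_itv/= => /andP[axo xob] _.
  (* Halving the interval costs a factor sqrt 2, rounded up to 2. *)
  have half (r u : R) : 0 < r -> 0 < u ->
      C0 * Num.sqrt (r / (u / 2)) <= C * Num.sqrt (r / u).
    move=> r0 u0; apply: (@le_trans _ _ (2 * C0 * Num.sqrt (r / u))); last first.
      by rewrite ler_wpM2r// sqrtr_ge0.
    rewrite -mulrA mulrCA ler_wpM2l//.
    have -> : 2 * Num.sqrt (r / u) = Num.sqrt (4 * (r / u)).
      rewrite [RHS]sqrtrM//; congr (_ * _).
      by rewrite (_ : 4 = 2 ^+ 2 :> R) ?sqrtr_sqr ?ger0_norm// -natrX.
    rewrite ler_wsqrtr// (_ : r / (u / 2) = 2 * (r / u)); last first.
      by field; rewrite gt_eqF.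
    have ru : 0 < r / u by rewrite divr_gt0.
    lra.
  apply: (@good_row_asymptotic R p x alpha d T P Y (fun n Un Ln =>
      (forall s, s \in `[ao, xo[ ->
         Un s <= lim (p t @[t --> xo^'-]) + C * Num.sqrt (rho n / (xo - s))) /\
      (forall s, s \in `]xo, bo] ->
         Ln s >= lim (p t @[t --> xo^'+]) - C * Num.sqrt (rho n / (s - xo))))) => //.
  apply: filterS band => n [r0 bnd] y gy; split=> s; rewrite in_itv/= => /andP[s1 s2].
    (* The comparison point must stay strictly left of xo, since p(xo) may exceed the left limit. *)
    pose t := s + (xo - s) / 2.
    have t1 : s < t by rewrite /t; lra.
    have t2 : t < xo by rewrite /t; lra.
    have [H _] := bnd y gy s t s1 t1 (ltW (lt_trans t2 xob)).
    apply: le_trans H _; rewrite lerD ?le_lim_at_left//.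
    rewrite (_ : t - s = (xo - s) / 2); last by rewrite /t; ring.
    by rewrite half// subr_gt0.
  pose t := s - (s - xo) / 2.
  have t1 : t < s by rewrite /t; lra.
  have t2 : xo < t by rewrite /t; lra.
  have [_ H] := bnd y gy t s (ltW (lt_trans axo t2)) t1 s2.
  apply: le_trans H; rewrite lerB ?lim_at_right_le//.
  rewrite (_ : s - t = (s - xo) / 2); last by rewrite /t; ring.
  by rewrite half// subr_gt0.
- move=> _; apply: filterS ev => n [n1 na des] s; rewrite in_itv/= => /andP[s1 s2].
  (* The bound holds for each t separately, with one n for all s and t, and therefore for the
     infimum; the endpoint bo shows that the set is nonempty. *)
  apply: expectation_le_inf => //.
  + by exists (p bo + rho n / (bo - s)), bo => //=; rewrite in_itv/= s2 lexx.
  + apply: expectation_ge0 => w.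
    have [_ lev1] := @raw_level_ge R n (x n) alpha (ltnW n1) alpha01 na.
    by case/andP: (@raw_upper01 R n (x n) (fun i => Y n i w) alpha s lev1).
  + move=> _ [t /= + <-]; rewrite in_itv/= => /andP[st tb].
    by apply: (@expectation_raw_upper R C1 C2 p n (x n) ao bo) => //; do [exact: xm|exact: Yp].
- move=> _; apply: filterS ev => n [n1 na des] s; rewrite in_itv/= => /andP[s1 s2].
  apply: expectation_le_inf => //.
  + by exists (1 - p ao + rho n / (s - ao)), ao => //=; rewrite in_itv/= s1 lexx.
  + apply: expectation_ge0 => w; rewrite subr_ge0.
    have [_ lev1] := @raw_level_ge R n (x n) alpha (ltnW n1) alpha01 na.
    by case/andP: (@raw_lower01 R n (x n) (fun i => Y n i w) alpha s lev1).
  + move=> _ [t /= + <-]; rewrite in_itv/= => /andP[st tb].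
    by apply: (@expectation_raw_lower R C1 C2 p n (x n) ao bo) => //; do [exact: xm|exact: Yp].
Unshelve. all: by end_near. Qed.
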